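(* Let $A$ and $H$ be cocommutative Hopf algebras over a field $k$ (with antipodes $S_A$ and $S_H$) such that $(A,\triangleleft,\triangleright)$ is an $H$-bimodule Hopf algebra. Let $R:A\to A$ be a linear map and let $B$ be a Rota-Baxter operator on $H$. Define a linear map $\overline{B}:A\natural H\to A\natural H$ on the L-R smash product by $$\overline{B}(a\natural h)=B(h_1)\triangleright R(a)\triangleleft B(h_2)\natural B(h_3),\qquad a\in A,\ h\in H.$$ Then $\overline{B}$ is a Rota-Baxter operator on $A\natural H$ if and only if $R$ is a Rota-Baxter operator on $A$ and, for all $a,b\in A$ and $g,h\in H$, $$R\Big(\big((a_1R(a_2))\triangleleft h_1\big)\, b\, \big(h_2\triangleright S_A(R(a_3))\big)\Big)=\big(S_H(B(h))\triangleright R(a)\big)R(b),$$ $$R\Big(g_{1}B(g_2)\triangleright b\triangleleft S_H(B(g_3))\Big)=R(b)\triangleleft S_H(B(g)).$$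
   Context: Sweedler notation $\Delta(x)=x_1\otimes x_2$ (summation omitted) is used, with iterated coproducts written $x_1\otimes x_2\otimes x_3$, etc. A Rota-Baxter operator on a cocommutative Hopf algebra $(H,S)$ is a coalgebra map $B:H\to H$ such that $B(x)B(y)=B\big(x_1B(x_2)\,y\,S(B(x_3))\big)$ for all $x,y\in H$. For Hopf algebras $A,H$, $A$ is an $H$-bimodule Hopf algebra if $A$ is an $H$-bimodule with left action $\triangleright:H\otimes A\to A$ and right action $\triangleleft:A\otimes H\to A$ (so $(h\triangleright a)\triangleleft g=h\triangleright(a\triangleleft g)$) such that $h\triangleright(ab)=(h_1\triangleright a)(h_2\triangleright b)$, $h\triangleright 1_A=\varepsilon(h)1_A$, $(ab)\triangleleft h=(a\triangleleft h_1)(b\triangleleft h_2)$, $1_A\triangleleft h=\varepsilon(h)1_A$, $\Delta(h\triangleright a)=h_1\triangleright a_1\otimes h_2\triangleright a_2$, $\Delta(a\triangleleft h)=a_1\triangleleft h_1\otimes a_2\triangleleft h_2$, $\varepsilon(h\triangleright a)=\varepsilon(a\triangleleft h)=\varepsilon(a)\varepsilon(h)$, and $S_A$ is $H$-bilinear. The L-R smash product $A\natural H$ is $A\otimes H$ (elements written $a\natural h$) with multiplication $(a\natural h)(b\natural g)=(a\triangleleft g_2)(h_1\triangleright b)\natural h_2g_1$, unit $1_A\natural 1_H$, comultiplication $\Delta(a\natural h)=(a_1\natural h_1)\otimes(a_2\natural h_2)$, counit $\varepsilon(a\natural h)=\varepsilon_A(a)\varepsilon_H(h)$ and antipode $S(a\natural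 h)=S_H(h_3)\triangleright S_A(a)\triangleleft S_H(h_2)\natural S_H(h_1)$; for cocommutative $H$ this is a Hopf algebra (cocommutative when $A$ and $H$ are). *)

(* Defs.v *)
(* Hopf algebras over a field k, presented with an explicit
   Sweedler coproduct.  MathComp has no tensor products of (possibly infinite
   dimensional) vector spaces, so an element of V (x) W is represented by a
   finite list of pure tensors  [:: (v_1,w_1); ...]  meaning  sum_i v_i (x) w_i,
   and two such lists are equal as tensors iff every k-bilinear map out of
   V x W (into an arbitrary k-vector space) takes the same value on them
   (universal property of the tensor product). *)
From HB Require Import structures.
From mathcomp Require Import all_boot all_order all_algebra.
Set Implicit Arguments. Unset Strict Implicit. Unset Printing Implicit Defensive.
Import GRing.Theory.
Local Open Scope ring_scope.

Section Hopf.
Variable k : fieldType.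

Definition bilin (V W U : lmodType k) (f : V -> W -> U) : Prop :=
  (forall (c : k) x x' y, f (c *: x + x') y = c *: f x y + f x' y) /\
  (forall (c : k) x y y', f x (c *: y + y') = c *: f x y + f x y').

Definition trilin (V W X U : lmodType k) (f : V -> W -> X -> U) : Prop :=
  [/\ (forall (c : k) x x' y z, f (c *: x + x') y z = c *: f x y z + f x' y z),
      (forall (c : k) x y y' z, f x (c *: y + y') z = c *: f x y z + f x y' z) &
      (forall (c : k) x y z z', f x y (c *: z + z') = c *: f x y z + f x y z')].

Definition tens_eq (V W : lmodType k) (l l' : seq (V * W)) : Prop :=
  forall (U : lmodType k) (f : V -> W -> U), bilin f ->
    \sum_(p <- l) f p.1 p.2 = \sum_(p <- l') f p.1 p.2.

Definition tens3_eq (V W X : lmodType k) (l l' : seq (V * W * X)) : Prop :=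
  forall (U : lmodType k) (f : V -> W -> X -> U), trilin f ->
    \sum_(p <- l) f p.1.1 p.1.2 p.2 = \sum_(p <- l') f p.1.1 p.1.2 p.2.

Definition tscale (V W : lmodType k) (c : k) (l : seq (V * W)) : seq (V * W) :=
  [seq (c *: p.1, p.2) | p <- l].

Definition cop2 (X : Type) (cop : X -> seq (X * X)) (x : X) : seq (X * X * X) :=
  flatten [seq [seq (q.1, q.2, p.2) | q <- cop p.1] | p <- cop x].
Definition cop2' (X : Type) (cop : X -> seq (X * X)) (x : X) : seq (X * X * X) :=
  flatten [seq [seq (p.1, q.1, q.2) | q <- cop p.2] | p <- cop x].

Definition is_bialgebra (H : algType k) (cop : H -> seq (H * H)) (eps : H -> k) : Prop :=
  [/\
      (forall (c : k) (x y : H),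
         tens_eq (V:=H) (W:=H) (cop (c *: x + y)) (tscale c (cop x) ++ cop y)),
      (forall x : H, tens3_eq (V:=H) (W:=H) (X:=H) (cop2 cop x) (cop2' cop x)),
      [/\ (forall (c : k) (x y : H), eps (c *: x + y) = c * eps x + eps y),
          (forall x : H, \sum_(p <- cop x) eps p.1 *: p.2 = x) &
          (forall x : H, \sum_(p <- cop x) eps p.2 *: p.1 = x)],
      (forall x y : H, tens_eq (V:=H) (W:=H) (cop (x * y))
                        [seq (p.1 * q.1, p.2 * q.2) | p <- cop x, q <- cop y])
        /\ tens_eq (V:=H) (W:=H) (cop 1) [:: (1, 1)] &
      (forall x y : H, eps (x * y) = eps x * eps y) /\ eps 1 = 1].

Definition is_hopf (H : algType k) (cop : H -> seq (H * H)) (eps : H -> k)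
    (S : H -> H) : Prop :=
  [/\ is_bialgebra cop eps,
      (forall (c : k) (x y : H), S (c *: x + y) = c *: S x + S y),
      (forall x : H, \sum_(p <- cop x) S p.1 * p.2 = (eps x)%:A) &
      (forall x : H, \sum_(p <- cop x) p.1 * S p.2 = (eps x)%:A)].

Definition is_cocomm (H : algType k) (cop : H -> seq (H * H)) : Prop :=
  forall x : H, tens_eq (V:=H) (W:=H) (cop x) [seq (p.2, p.1) | p <- cop x].

Definition is_bimod_hopf (A H : algType k)
    (copA : A -> seq (A * A)) (epsA : A -> k) (SA : A -> A)
    (copH : H -> seq (H * H)) (epsH : H -> k)
    (lact : H -> A -> A) (ract : A -> H -> A) : Prop :=
  [/\
      [/\ bilin lact, bilin ract,
          (forall a : A, lact 1 a = a) /\ (forall (h g : H) (a : A), lact (h * g) a = lact h (lact g a)),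
          (forall a : A, ract a 1 = a) /\ (forall (a : A) (h g : H), ract a (h * g) = ract (ract a h) g) &
          (forall (h : H) (a : A) (g : H), ract (lact h a) g = lact h (ract a g))],
      [/\ (forall (h : H) (a b : A), lact h (a * b) = \sum_(p <- copH h) lact p.1 a * lact p.2 b),
          (forall h : H, lact h 1 = (epsH h)%:A),
          (forall (a b : A) (h : H), ract (a * b) h = \sum_(p <- copH h) ract a p.1 * ract b p.2) &
          (forall h : H, ract 1 h = (epsH h)%:A)],
      [/\ (forall (h : H) (a : A), tens_eq (V:=A) (W:=A) (copA (lact h a))
              [seq (lact p.1 q.1, lact p.2 q.2) | p <- copH h, q <- copA a]),
          (forall (a : A) (h : H), tens_eq (V:=A) (W:=A) (copA (ract a h))
              [seq (ract q.1 p.1, ract q.2 p.2) | q <- copA a, p <- copH h]),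
          (forall (h : H) (a : A), epsA (lact h a) = epsA a * epsH h) &
          (forall (a : A) (h : H), epsA (ract a h) = epsA a * epsH h)] &
      (forall (h : H) (a : A), SA (lact h a) = lact h (SA a)) /\
      (forall (a : A) (h : H), SA (ract a h) = ract (SA a) h)].

(* ---------- Rota-Baxter operators, uniformly for Hopf algebras whose
   carrier is a vector space up to an equivalence (needed for A # H,
   whose elements are tensors) ---------- *)
Record swalg := SwAlg {
  sw_car : Type;
  sw_eqv : sw_car -> sw_car -> Prop;
  sw_add : sw_car -> sw_car -> sw_car;
  sw_zero : sw_car;
  sw_scale : k -> sw_car -> sw_car;
  sw_mul : sw_car -> sw_car -> sw_car;
  sw_eps : sw_car -> k;
  sw_S : sw_car -> sw_car;
  sw_cop : sw_car -> seq (sw_car * sw_car) }.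

Arguments sw_eqv {X} : rename.
Arguments sw_add {X} : rename.
Arguments sw_zero {X} : rename.
Arguments sw_scale {X} : rename.
Arguments sw_mul {X} : rename.
Arguments sw_eps {X} : rename.
Arguments sw_S {X} : rename.
Arguments sw_cop {X} : rename.

Definition sw_bilin (X : swalg) (U : lmodType k) (f : sw_car X -> sw_car X -> U) : Prop :=
  [/\ (forall x x' y, sw_eqv x x' -> f x y = f x' y),
      (forall x y y', sw_eqv y y' -> f x y = f x y'),
      (forall (c : k) x x' y, f (sw_add (sw_scale c x) x') y = c *: f x y + f x' y) &
      (forall (c : k) x y y', f x (sw_add (sw_scale c y) y') = c *: f x y + f x y')].

Definition sw_teq2 (X : swalg) (l l' : seq (sw_car X * sw_car X)) : Prop :=
  forall (U : lmodType k) (f : sw_car X -> sw_car X -> U), sw_bilin f ->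
    \sum_(p <- l) f p.1 p.2 = \sum_(p <- l') f p.1 p.2.

Definition sw_sum (X : swalg) (s : seq (sw_car X)) : sw_car X :=
  foldr sw_add sw_zero s.

Definition is_RB (X : swalg) (B : sw_car X -> sw_car X) : Prop :=
  [/\ (forall x x', sw_eqv x x' -> sw_eqv (B x) (B x')),
      (forall (c : k) x y, sw_eqv (B (sw_add (sw_scale c x) y)) (sw_add (sw_scale c (B x)) (B y))),
      (forall x, sw_teq2 (sw_cop (B x)) [seq (B p.1, B p.2) | p <- sw_cop x]),
      (forall x, sw_eps (B x) = sw_eps x) &
      (forall x y, sw_eqv (sw_mul (B x) (B y))
         (B (sw_sum [seq sw_mul (sw_mul (sw_mul t.1.1 (B t.1.2)) y) (sw_S (B t.2))
                    | t <- cop2 (@sw_cop X) x])))].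

Definition alg_swalg (H : algType k) (cop : H -> seq (H * H)) (eps : H -> k)
    (S : H -> H) : swalg :=
  @SwAlg H (@eq H) (fun x y => x + y) 0 (fun c x => c *: x) (fun x y => x * y) eps S cop.

Section Smash.
Variables (A H : algType k).
Variables (copA : A -> seq (A * A)) (epsA : A -> k) (SA : A -> A).
Variables (copH : H -> seq (H * H)) (epsH : H -> k) (SH : H -> H).
Variables (lact : H -> A -> A) (ract : A -> H -> A).

Definition smash_eqv (l l' : seq (A * H)) : Prop := tens_eq (V:=A) (W:=H) l l'.

Definition smash_mul_pure (x y : A * H) : seq (A * H) :=
  [seq (ract x.1 g.2 * lact h.1 y.1, h.2 * g.1) | h <- copH x.2, g <- copH y.2].
Definition smash_mul (l l' : seq (A * H)) : seq (A * H) :=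
  flatten [seq smash_mul_pure x y | x <- l, y <- l'].

Definition smash_eps (l : seq (A * H)) : k := \sum_(p <- l) epsA p.1 * epsH p.2.

Definition smash_S (l : seq (A * H)) : seq (A * H) :=
  flatten [seq [seq (lact (SH t.2) (ract (SA x.1) (SH t.1.2)), SH t.1.1)
               | t <- cop2 copH x.2] | x <- l].

Definition smash_cop (l : seq (A * H)) : seq (seq (A * H) * seq (A * H)) :=
  flatten [seq [seq ([:: (p.1, q.1)], [:: (p.2, q.2)]) | p <- copA x.1, q <- copH x.2]
          | x <- l].

Definition smash_swalg : swalg :=
  @SwAlg (seq (A * H)) smash_eqv (fun l l' => l ++ l') [::] (tscale (V:=A) (W:=H))
    smash_mul smash_eps smash_S smash_cop.

Definition smash_RB (R : A -> A) (B : H -> H) (l : seq (A * H)) : seq (A * H) :=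
  flatten [seq [seq (ract (lact (B t.1.1) (R x.1)) (B t.1.2), B t.2) | t <- cop2 copH x.2]
          | x <- l].
End Smash.

End Hopf.

Arguments is_RB {k} X B.

(* Main.v *)
(* Cocommutative Hopf algebras are group objects in cocommutative coalgebras: for
   a cocommutative coalgebra [X], the coalgebra maps [X -> H] (the [X]-points) form a
   group under convolution, [H] acts on both sides of [A] by commuting group
   automorphisms at the level of points, and coalgebra maps such as [B] and [R] act
   on points.  On points [a # h], [b # g], with p = B h and q = B g, the Rota-Baxter
   identity of [Bbar] reduces to
     R ((a<|pgp^-1) (hp|>Ra<|pgp^-1) (hp|>b<|p^-1) (hpg|>(Ra)^-1))
       = (q^-1|>Ra) (Rb<|p^-1).
   Taking h = 1 gives the first condition and a = 1 the second one.  Conversely the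
   second condition gives Ra = R a' <| p^-1 with a' = (hp)^-1|>a<|p; the first one for
   a', b, g, acted on by p^-1, then turns into the identity by the second one.
   Identities between points over all [X] are the same as pointwise ones, by
   evaluation at the projections of product coalgebras.  The coalgebra axioms for [R]
   follow from Bbar (a # 1) = R a # 1. *)

Require Import Defs.
From HB Require Import structures.
From mathcomp Require Import all_boot all_order all_algebra.
From Stdlib Require Import FunctionalExtensionality ProofIrrelevance.
Set Implicit Arguments. Unset Strict Implicit. Unset Printing Implicit Defensive.
Import GRing.Theory.
Local Open Scope ring_scope.

(** * Coalgebras and Sweedler sums *)

Section Coalgebras.
Variable k : fieldType.

(** Two obstacles shape the proof. Tensors are lists that can only be compared through bilinear
    maps, so [A # H] is never turned into a Hopf algebra of the same kind as [A] and [H]. A point of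
    [A # H] is kept instead as a pair of a point of [A] and a point of [H], tied to lists by [rep];
    product, antipode and [Bbar] become formulas on such pairs, and equality of tensors is tested by
    the functionals [ladm]. Secondly, [R] acts on points only once it is a coalgebra map, which in
    one direction must be proved first; hence a bare linear [R] is carried along, and a point [Rp]
    with the same values is added when available. The longer rearrangements of Sweedler factors are
    delegated to a single lemma, [swt_perm], on arbitrary bracketings. The Rota-Baxter identity of
    [R] has no counterpart in the group statement: it is the first condition at [h = 1], because
    [B 1 = 1]. *)

Definition lin (V U : lmodType k) (f : V -> U) : Prop :=
  forall (c : k) x y, f (c *: x + y) = c *: f x + f y.

Definition swl (T : Type) (U : lmodType k) (l : seq (T * T)) (f : T -> T -> U) : U :=
  \sum_(p <- l) f p.1 p.2.

(* A cocommutative coalgebra presented by a set of generators: [adm] singles out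
   the functions on generators that extend linearly, so that product coalgebras
   live on plain cartesian products instead of tensor products. *)
Record coalg := Coalg {
  ccar :> Type;
  adm : forall U : lmodType k, (ccar -> U) -> Prop;
  ccop : ccar -> seq (ccar * ccar);
  ceps : ccar -> k;
  adm_lin : forall (U V : lmodType k) (g : U -> V) (f : ccar -> U),
    lin g -> adm f -> adm (fun x => g (f x));
  adm_comb : forall (U : lmodType k) (c : k) (f g : ccar -> U),
    adm f -> adm g -> adm (fun x => c *: f x + g x);
  adm_ceps : adm (U := k^o) ceps;
  adm_swl : forall (U : lmodType k) (f : ccar -> ccar -> U),
    (forall y, adm (fun x => f x y)) -> (forall x, adm (f x)) ->
    adm (fun x => swl (ccop x) f);
  swl_assoc : forall (U : lmodType k) (f : ccar -> ccar -> ccar -> U),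
    (forall y z, adm (fun x => f x y z)) -> (forall x z, adm (fun y => f x y z)) ->
    (forall x y, adm (f x y)) ->
    forall x, swl (ccop x) (fun y z => swl (ccop y) (fun u v => f u v z)) =
              swl (ccop x) (fun y z => swl (ccop z) (fun u v => f y u v));
  swl_comm : forall (U : lmodType k) (f : ccar -> ccar -> U),
    (forall y, adm (fun x => f x y)) -> (forall x, adm (f x)) ->
    forall x, swl (ccop x) f = swl (ccop x) (fun y z => f z y);
  swl_counit : forall (U : lmodType k) (f : ccar -> U), adm f ->
    forall x, swl (ccop x) (fun y z => ceps y *: f z) = f x }.

Definition sw (X : coalg) (U : lmodType k) (x : X) (f : X -> X -> U) : U :=
  swl (ccop x) f.

Lemma lin_sum (V U : lmodType k) (g : V -> U) (I : Type) (s : seq I) (F : I -> V) :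
  lin g -> g (\sum_(i <- s) F i) = \sum_(i <- s) g (F i).
Proof.
move=> hg; elim: s => [|i s IH]; last first.
  by rewrite !big_cons -IH -[X in g (X + _)]scale1r hg scale1r.
rewrite !big_nil; have := hg 1 0 0.
by rewrite !scale1r addr0 => /(congr1 (fun z => z - g 0)); rewrite subrr addrK.
Qed.

Lemma linZ (V U : lmodType k) (g : V -> U) c x : lin g -> g (c *: x) = c *: g x.
Proof.
move=> hg; rewrite -[c *: x]addr0 hg.
have := lin_sum [::] (fun _ : nat => 0) hg; rewrite !big_nil => ->.
by rewrite addr0.
Qed.

Section Basics.
Variable X : coalg.
Implicit Types (U V W : lmodType k).

(** The counit is the only function that the record declares admissible outright, so the zero
    function is obtained as the zero map after it. *)
Lemma adm0 U : adm (fun _ : X => 0 : U).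
Proof.
have h0 : lin (fun _ : k^o => 0 : U) by move=> c x y; rewrite scaler0 addr0.
exact: adm_lin h0 (adm_ceps X).
Qed.

Lemma adm_sum U (I : Type) (s : seq I) (F : I -> X -> U) :
  (forall i, adm (F i)) -> adm (fun x => \sum_(i <- s) F i x).
Proof.
move=> hF; elim: s => [|i s IH].
  rewrite (_ : (fun _ => _) = fun=> 0); first exact: adm0.
  by apply: functional_extensionality => x; rewrite big_nil.
rewrite (_ : (fun _ => _) = fun x => 1 *: F i x + \sum_(i <- s) F i x).
  exact: adm_comb.
by apply: functional_extensionality => x; rewrite big_cons scale1r.
Qed.

Lemma adm_sw U (f : X -> X -> U) :
  (forall y, adm (fun x => f x y)) -> (forall x, adm (f x)) -> adm (fun x => sw x f).
Proof. exact: adm_swl. Qed.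

(** Only the parameter of the summand varies: the index list is fixed, and a finite sum of
    admissible functions is admissible. *)
Lemma adm_sw_par (Y : coalg) U (y : Y) (f : X -> Y -> Y -> U) :
  (forall u v, adm (fun x => f x u v)) -> adm (fun x => sw y (f x)).
Proof. by move=> hf; apply: adm_sum => p. Qed.

Lemma sw_assoc U (f : X -> X -> X -> U) x :
  (forall y z, adm (fun x => f x y z)) -> (forall x z, adm (fun y => f x y z)) ->
  (forall x y, adm (f x y)) ->
  sw x (fun y z => sw y (fun u v => f u v z)) = sw x (fun y z => sw z (fun u v => f y u v)).
Proof. by move=> *; apply: swl_assoc. Qed.

Lemma sw_comm U (f : X -> X -> U) x :
  (forall y, adm (fun x => f x y)) -> (forall x, adm (f x)) ->
  sw x f = sw x (fun y z => f z y).
Proof. by move=> *; apply: swl_comm. Qed.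

Lemma sw_counitl U (f : X -> U) x : adm f -> sw x (fun y z => ceps y *: f z) = f x.
Proof. by move=> hf; apply: swl_counit. Qed.

Lemma eq_sw U (x : X) (f g : X -> X -> U) :
  (forall y z, f y z = g y z) -> sw x f = sw x g.
Proof. by move=> h; apply: eq_bigr => p _. Qed.

Lemma lin_sw U V (h : U -> V) (x : X) (f : X -> X -> U) :
  lin h -> h (sw x f) = sw x (fun y z => h (f y z)).
Proof. exact: lin_sum. Qed.

Lemma sw_exch (Y : coalg) U (x : X) (y : Y) (f : X -> X -> Y -> Y -> U) :
  sw x (fun a b => sw y (f a b)) = sw y (fun c d => sw x (fun a b => f a b c d)).
Proof. exact: exchange_big. Qed.

Lemma adm_bl U V W (m : U -> V -> W) (f : X -> U) c :
  bilin m -> adm f -> adm (fun x => m (f x) c).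
Proof. by move=> [hm _]; apply: (@adm_lin X _ _ (m^~ c)) => a u v; apply: hm. Qed.

Lemma adm_br U V W (m : U -> V -> W) (f : X -> V) c :
  bilin m -> adm f -> adm (fun x => m c (f x)).
Proof. by move=> [_ hm]; apply: (@adm_lin X _ _ (m c)) => a u v; apply: hm. Qed.

End Basics.

Lemma bilin_intro (V W U : lmodType k) (f : V -> W -> U) :
  (forall y, lin (fun x => f x y)) -> (forall x, lin (f x)) -> bilin f.
Proof. by move=> h1 h2; split=> *; [apply: h1 | apply: h2]. Qed.

Lemma bilin_scale (V : lmodType k) : bilin (V := k^o) (W := V) (U := V) *:%R.
Proof.
split=> c x y z; first by rewrite scalerDl scalerA.
by rewrite scalerDr scalerA mulrC -scalerA.
Qed.

Lemma bilin_mul (K : algType k) : bilin (V := K) (W := K) (U := K) *%R.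
Proof.
by split=> c x y z; [rewrite mulrDl scalerAl | rewrite mulrDr scalerAr].
Qed.

Lemma bilin_linl (V W U : lmodType k) (f : V -> W -> U) y :
  bilin f -> lin (fun x => f x y).
Proof. by case=> h _ c x x'; apply: h. Qed.

Lemma bilin_linr (V W U : lmodType k) (f : V -> W -> U) x : bilin f -> lin (f x).
Proof. by case=> _ h c y y'; apply: h. Qed.

(** * Generalized coassociativity and cocommutativity *)

Section Trees.
Variable X : coalg.
Implicit Types U : lmodType k.

Inductive tree := Lf | Nd of tree & tree.

Fixpoint leaves t := if t is Nd l r then (leaves l + leaves r)%N else 1%N.

(** The right comb is the normal form of a bracketing; [comb n] has [n.+1] leaves, whence the
    predecessors below. *)
Fixpoint comb n := if n is n'.+1 then Nd Lf (comb n') else Lf.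

(* [swt t x f] is the iterated Sweedler sum of shape [t]; the leaves are passed to
   [f] in order. *)
Fixpoint swt U (t : tree) (x : X) (f : seq X -> U) : U :=
  if t is Nd l r
  then sw x (fun y z => swt l y (fun a => swt r z (fun b => f (a ++ b))))
  else f [:: x].

Fixpoint alln n (P : seq X -> Prop) : Prop :=
  if n is n'.+1 then forall x, alln n' (fun l => P (x :: l)) else P [::].

(** Multilinearity on lists of length [n]; values on lists of other lengths are unconstrained. *)
Fixpoint madm U n (f : seq X -> U) : Prop :=
  if n is n'.+1
  then alln n' (fun l => adm (fun x => f (x :: l))) /\ forall x, madm n' (fun l => f (x :: l))
  else True.

Lemma allnP n (P : seq X -> Prop) : alln n P <-> forall l, size l = n -> P l.
Proof.
elim: n P => [|n IH] P /=; first by split=> [h [] // | h]; apply: h.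
split=> [h [] // x l [hl] | h x]; first exact: (proj1 (IH _) (h x)).
by apply/IH => l hl; apply: h => /=; rewrite hl.
Qed.

Lemma eq_swt U t (x : X) (f g : seq X -> U) :
  (forall l, size l = leaves t -> f l = g l) -> swt t x f = swt t x g.
Proof.
elim: t x f g => [|l IHl r IHr] x f g h /=; first exact: h.
apply: eq_sw => y z; apply: IHl => a ha; apply: IHr => b hb.
by apply: h; rewrite size_cat ha hb.
Qed.

Lemma adm_swt_par (Y : coalg) U t (x : X) (f : Y -> seq X -> U) :
  (forall l, size l = leaves t -> adm (fun y => f y l)) -> adm (fun y => swt t x (f y)).
Proof.
elim: t x f => [|l IHl r IHr] x f h /=; first exact: h.
apply: adm_sw_par => u v; apply: IHl => a ha; apply: IHr => b hb.
by apply: h; rewrite size_cat ha hb.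
Qed.

Lemma leaves_comb n : leaves (comb n) = n.+1.
Proof. by elim: n => //= n ->. Qed.

Lemma leaves_gt0 t : (0 < leaves t)%N.
Proof. by elim: t => //= l h r _; rewrite addn_gt0 h. Qed.

Lemma madm_swt U m t z (f : seq X -> U) :
  madm (m + leaves t) f -> madm m (fun a => swt t z (fun b => f (a ++ b))).
Proof.
elim: m f => [|m IH] f //= [/allnP h1 h2].
split=> [|x]; last exact: (IH (fun l => f (x :: l)) (h2 x)).
apply/allnP => a ha; apply: adm_swt_par => b hb.
by apply: h1; rewrite size_cat ha hb.
Qed.

Lemma madm_drop U m n (f : seq X -> U) a : size a = m ->
  madm (m + n) f -> madm n (fun b => f (a ++ b)).
Proof.
by elim: m a f => [[]|m IH [] //= x a f [ha] [_ /(_ x)]] //; apply: IH.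
Qed.

Lemma adm_swt U t (f : seq X -> U) : madm (leaves t) f -> adm (fun x => swt t x f).
Proof.
elim: t f => [|l IHl r IHr] f; first by case.
move=> h; apply: adm_sw => [z | y].
  by apply: IHl; exact: madm_swt.
apply: adm_swt_par => a ha; apply: IHr; exact: madm_drop h.
Qed.

(** One use of coassociativity frees the head of the left comb from its bracket; the induction
    grafts what is left of that comb onto the right one. *)
Lemma swt_comb_cat U m n (x : X) (f : seq X -> U) : madm (m + n).+2 f ->
  sw x (fun y z => swt (comb m) y (fun a => swt (comb n) z (fun b => f (a ++ b)))) =
  swt (comb (m + n).+1) x f.
Proof.
elim: m x f => [//|m IH] x f h /=.
rewrite [LHS](@sw_assoc _ _ (fun u v z =>
   swt (comb m) v (fun a => swt (comb n) z (fun b => f (u :: a ++ b))))).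
- by apply: eq_sw => y z; apply: (IH z (fun l => f (y :: l))); case: h => _; exact.
- move=> y z; apply: adm_swt_par => a; rewrite leaves_comb => ha.
  apply: adm_swt_par => b; rewrite leaves_comb => hb.
  by case: h => /allnP h _; apply: h; rewrite size_cat ha hb addSn addnS.
- move=> u z; apply: adm_swt; rewrite leaves_comb; case: h => _ /(_ u) h.
  apply: (@madm_swt _ m.+1 (comb n) z (fun l => f (u :: l))).
  by rewrite leaves_comb addSn addnS.
- move=> u v; apply: adm_swt_par => a; rewrite leaves_comb => ha.
  apply: adm_swt; rewrite leaves_comb; case: h => _ /(_ u) h.
  by apply: (@madm_drop _ m.+1 n.+1 (fun l => f (u :: l))) => //; rewrite addSn addnS.
Qed.

Lemma swt_comb U t (x : X) (f : seq X -> U) :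
  madm (leaves t) f -> swt t x f = swt (comb (leaves t).-1) x f.
Proof.
elim: t x f => [//|l IHl r IHr] x f h /=.
have -> : (leaves l + leaves r).-1 = ((leaves l).-1 + (leaves r).-1).+1.
  by case: (leaves l) (leaves_gt0 l) (leaves r) (leaves_gt0 r) => [//|m] _ [//|n] _; rewrite addnS.
rewrite -swt_comb_cat; last first.
  by move: h => /=; case: (leaves l) (leaves_gt0 l) (leaves r) (leaves_gt0 r) => [//|m] _ [//|n] _; rewrite addnS.
apply: eq_sw => y z; rewrite IHl.
  apply: eq_swt => a; rewrite leaves_comb prednK ?leaves_gt0 // => ha.
  by apply: IHr; exact: madm_drop h.
exact: madm_swt.
Qed.

Fixpoint swp (T : Type) i (l : seq T) : seq T :=
  match i, l with
  | 0, a :: b :: l' => b :: a :: l'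
  | i'.+1, a :: l' => a :: swp i' l'
  | _, _ => l
  end.

Lemma size_swp (T : Type) i (l : seq T) : size (swp i l) = size l.
Proof. by elim: i l => [[|a []]|i IH []] //= a l; rewrite IH. Qed.

Lemma madm_swp U n i (f : seq X -> U) : madm n f -> madm n (fun l => f (swp i l)).
Proof.
elim: i n f => [|i IH] [|n] f //=; last first.
  case=> /allnP h1 h2; split=> [|x]; last exact: (IH n (fun l => f (x :: l))).
  by apply/allnP => l hl; apply: h1; rewrite size_swp.
case: n => [//|n] /= [h1 h2]; split.
  by move=> y; case: (h2 y).
move=> x; split=> [|y]; last by case: (h2 y) => _ /(_ x).
by apply/allnP => l hl; move/(_ x)/allnP: h1; apply.
Qed.

(** At the head, coassociativity brackets the first two leaves together, cocommutativity exchanges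
    them, and coassociativity restores the comb. Deeper positions are reached by peeling leaves
    off. *)
Lemma swt_swp U n i (x : X) (f : seq X -> U) : madm n.+1 f ->
  swt (comb n) x f = swt (comb n) x (fun l => f (swp i l)).
Proof.
have n0 j y (g : seq X -> U) : g [:: y] = g (swp j [:: y]) by case: j => //= -[].
elim: i n x f => [|i IH] [|n] x f h; try exact: n0; last first.
  by apply: eq_sw => y z; apply: (IH n z (fun l => f (y :: l))); case: h => _; exact.
case: n h => [|n] h /=.
  rewrite [LHS]sw_comm //; first by move=> y; case: h => /(_ y).
  by move=> y; case: h => _ /(_ y) [].
have a1 y z : adm (fun u => swt (comb n) z (fun a => f (u :: y :: a))).
  apply: adm_swt_par => l; rewrite leaves_comb => hl; case: h => h _.
  by apply: (proj1 (allnP _ _) h (y :: l)) => /=; rewrite hl.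
have a2 y z : adm (fun u => swt (comb n) z (fun a => f (y :: u :: a))).
  by apply: adm_swt_par => l; rewrite leaves_comb => hl; case: h => _ /(_ y) [/allnP h _]; exact: h.
have a3 y z : adm (fun u => swt (comb n) u (fun a => f (y :: z :: a))).
  by apply: adm_swt; rewrite leaves_comb; case: h => _ /(_ y) [_ /(_ z)].
rewrite -(@sw_assoc _ _ (fun y u v => swt (comb n) v (fun a => f (y :: u :: a)))) //.
rewrite -(@sw_assoc _ _ (fun y u v => swt (comb n) v (fun a => f (u :: y :: a)))) //.
by apply: eq_sw => y z; apply: sw_comm.
Qed.

(** Adjacent transpositions generate all permutations, so this relates any two bracketings with
    equally many leaves under any reordering. The word [s] acts on the leaves of [t'] with its last
    index first. *)
Lemma swt_perm U t t' s (x : X) (f : seq X -> U) :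
  leaves t = leaves t' -> madm (leaves t) f ->
  swt t x f = swt t' x (fun l => f (foldr (@swp _) l s)).
Proof.
move=> e h; rewrite swt_comb // e [RHS]swt_comb; last first.
  by move: h; rewrite e => h; elim: s f h => [|i s IH] f h //=; apply: (IH (fun l => f (swp i l))); exact: madm_swp.
have : madm (leaves t').-1.+1 f.
  by rewrite -e prednK ?leaves_gt0.
elim: s f {h} => [|i s IH] f h //=; rewrite (swt_swp i) //.
exact: (IH (fun l => f (swp i l)) (madm_swp i h)).
Qed.

End Trees.
End Coalgebras.
Section Scaling.
Variables (k : fieldType) (X : coalg k) (U : lmodType k).

Lemma adm_ceps_scale (v : U) : adm (fun x : X => ceps x *: v).
Proof. exact: (@adm_bl _ X k^o U U *:%R _ v (bilin_scale U) (adm_ceps X)). Qed.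

Lemma adm_scale c (f : X -> U) : adm f -> adm (fun x => c *: f x).
Proof. exact: (@adm_br _ X k^o U U *:%R f c (bilin_scale U)). Qed.

End Scaling.

Ltac bil := first [ assumption | exact: bilin_mul ].
Ltac admt := first
  [ assumption
  | exact: adm_ceps_scale
  | apply: adm_scale; admt
  | apply: adm_bl; [bil | admt]
  | apply: adm_br; [bil | admt] ].

(** * Products of coalgebras *)

Section Products.
Variable k : fieldType.
Variables X Y : coalg k.

Definition prod_adm (U : lmodType k) (f : X * Y -> U) : Prop :=
  (forall y, adm (fun x => f (x, y))) /\ (forall x, adm (fun y => f (x, y))).

Definition prod_cop (z : X * Y) : seq ((X * Y) * (X * Y)) :=
  [seq ((p.1, q.1), (p.2, q.2)) | p <- ccop z.1, q <- ccop z.2].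

Lemma swl_prod (U : lmodType k) (z : X * Y) (f : X * Y -> X * Y -> U) :
  swl (prod_cop z) f = sw z.1 (fun a b => sw z.2 (fun c d => f (a, c) (b, d))).
Proof. by rewrite /swl big_allpairs_dep. Qed.

Definition prod_eps (z : X * Y) : k := ceps z.1 * ceps z.2.

Lemma prod_adm_lin (U V : lmodType k) (g : U -> V) (f : X * Y -> U) :
  lin g -> prod_adm f -> prod_adm (fun z => g (f z)).
Proof. by move=> hg [h1 h2]; split=> z; [exact: adm_lin (h1 z) | exact: adm_lin (h2 z)]. Qed.

Lemma prod_adm_comb (U : lmodType k) (c : k) (f g : X * Y -> U) :
  prod_adm f -> prod_adm g -> prod_adm (fun z => c *: f z + g z).
Proof. by move=> [h1 h2] [h3 h4]; split=> z; exact: adm_comb. Qed.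

Lemma prod_adm_eps : prod_adm (U := k^o) prod_eps.
Proof.
split=> z.
  exact: (adm_ceps_scale X (ceps z : k^o)).
exact: (adm_scale (ceps z) (adm_ceps Y)).
Qed.

Lemma prod_adm_swl (U : lmodType k) (f : X * Y -> X * Y -> U) :
  (forall y, prod_adm (fun x => f x y)) -> (forall x, prod_adm (f x)) ->
  prod_adm (fun z => swl (prod_cop z) f).
Proof.
move=> h1 h2; split=> z.
  rewrite (_ : (fun _ => _) = fun x => sw x (fun a b => sw z (fun c d => f (a, c) (b, d)))).
    by apply: adm_sw => u; apply: adm_sw_par => c d; [case: (h1 (u, d)) | case: (h2 (u, c))].
  by apply: functional_extensionality => x; rewrite swl_prod.
rewrite (_ : (fun _ => _) = fun y => sw y (fun c d => sw z (fun a b => f (a, c) (b, d)))).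
  by apply: adm_sw => u; apply: adm_sw_par => c d; [case: (h1 (d, u)) | case: (h2 (c, u))].
by apply: functional_extensionality => x; rewrite swl_prod sw_exch.
Qed.

Lemma prod_swl_assoc (U : lmodType k) (f : X * Y -> X * Y -> X * Y -> U) :
  (forall y z, prod_adm (fun x => f x y z)) -> (forall x z, prod_adm (fun y => f x y z)) ->
  (forall x y, prod_adm (f x y)) ->
  forall x, swl (prod_cop x) (fun y z => swl (prod_cop y) (fun u v => f u v z)) =
            swl (prod_cop x) (fun y z => swl (prod_cop z) (fun u v => f y u v)).
Proof.
move=> h1 h2 h3 [x y]; rewrite !swl_prod /=.
(* The sums over [X] are separated from those over [Y], so that coassociativity of each factor
   applies on its own. *)
transitivity (sw x (fun a b => sw a (fun a1 a2 => sw y (fun c d => sw c (fun c1 c2 =>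
    f (a1, c1) (a2, c2) (b, d)))))).
  apply: eq_sw => a b; rewrite sw_exch; apply: eq_sw => c d.
  by rewrite swl_prod.
transitivity (sw x (fun a b => sw b (fun b1 b2 => sw y (fun c d => sw d (fun d1 d2 =>
    f (a, c) (b1, d1) (b2, d2)))))); last first.
  apply: eq_sw => a b; rewrite sw_exch; apply: eq_sw => c d.
  by rewrite swl_prod.
rewrite (@sw_assoc _ X _ (fun a1 a2 b => sw y (fun c d => sw c (fun c1 c2 =>
    f (a1, c1) (a2, c2) (b, d))))).
- apply: eq_sw => a b; apply: eq_sw => a1 a2.
  apply: (@sw_assoc _ Y _ (fun c1 c2 d => f (a, c1) (a1, c2) (a2, d))) => u v.
  + by case: (h1 (a1, u) (a2, v)).
  + by case: (h2 (a, u) (a2, v)).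
  + by case: (h3 (a, u) (a1, v)).
- move=> u v; apply: adm_sw_par => c d; apply: adm_sw_par => c1 c2.
  by case: (h1 (u, c2) (v, d)).
- move=> u v; apply: adm_sw_par => c d; apply: adm_sw_par => c1 c2.
  by case: (h2 (u, c1) (v, d)).
- move=> u v; apply: adm_sw_par => c d; apply: adm_sw_par => c1 c2.
  by case: (h3 (u, c1) (v, c2)).
Qed.

Lemma prod_swl_comm (U : lmodType k) (f : X * Y -> X * Y -> U) :
  (forall y, prod_adm (fun x => f x y)) -> (forall x, prod_adm (f x)) ->
  forall x, swl (prod_cop x) f = swl (prod_cop x) (fun y z => f z y).
Proof.
move=> h1 h2 [x y]; rewrite !swl_prod /= sw_comm.
- apply: eq_sw => a b; apply: sw_comm => u; first by case: (h1 (a, u)).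
  by case: (h2 (b, u)).
- by move=> u; apply: adm_sw_par => c d; case: (h1 (u, d)).
- by move=> u; apply: adm_sw_par => c d; case: (h2 (u, c)).
Qed.

Lemma prod_swl_counit (U : lmodType k) (f : X * Y -> U) : prod_adm f ->
  forall x, swl (prod_cop x) (fun y z => prod_eps y *: f z) = f x.
Proof.
move=> [h1 h2] [x y]; rewrite swl_prod /=.
rewrite -[RHS](@sw_counitl _ X _ (fun x => f (x, y))) //.
apply: eq_sw => a b; rewrite -[RHS]/((fun z => ceps a *: z) (f (b, y))).
rewrite -(@sw_counitl _ Y _ (fun y => f (b, y))) // lin_sw.
  by apply: eq_sw => c d; rewrite /prod_eps scalerA.
exact: (bilin_linr _ (bilin_scale U)).
Qed.

Definition prodC : coalg k :=
  Coalg prod_adm_lin prod_adm_comb prod_adm_eps prod_adm_swl prod_swl_assoc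
    prod_swl_comm prod_swl_counit.

Lemma sw_prod (U : lmodType k) (z : prodC) (f : prodC -> prodC -> U) :
  sw z f = sw z.1 (fun a b => sw z.2 (fun c d => f (a, c) (b, d))).
Proof. exact: swl_prod. Qed.

End Products.

Lemma big_cop2 (V : nmodType) (T : Type) (cop : T -> seq (T * T)) (x : T) (F : T * T * T -> V) :
  \sum_(t <- cop2 cop x) F t = \sum_(p <- cop x) \sum_(q <- cop p.1) F (q.1, q.2, p.2).
Proof.
by rewrite big_flatten big_map; apply: eq_bigr => p _; rewrite big_map.
Qed.

Lemma big_cop2' (V : nmodType) (T : Type) (cop : T -> seq (T * T)) (x : T) (F : T * T * T -> V) :
  \sum_(t <- cop2' cop x) F t = \sum_(p <- cop x) \sum_(q <- cop p.2) F (p.1, q.1, q.2).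
Proof.
by rewrite big_flatten big_map; apply: eq_bigr => p _; rewrite big_map.
Qed.

(** * Cocommutative Hopf algebras as coalgebras *)

Section HopfCoalgebras.
Variable k : fieldType.

Record chopf := CHopf {
  halg :> algType k;
  hcop : halg -> seq (halg * halg);
  heps : halg -> k;
  hS : halg -> halg;
  hopfP : is_hopf hcop heps hS;
  hcocomm : is_cocomm hcop }.

Section CoalgOf.
Variable K : chopf.

Lemma h_adm_comb (U : lmodType k) (c : k) (f g : K -> U) :
  lin f -> lin g -> lin (fun x => c *: f x + g x).
Proof.
move=> hf hg a x y; rewrite hf hg !scalerDr !scalerA (mulrC c a).
by rewrite -!scalerA !addrA; congr (_ + _); rewrite addrAC.
Qed.

Lemma h_adm_lin (U V : lmodType k) (g : U -> V) (f : K -> U) :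
  lin g -> lin f -> lin (fun x => g (f x)).
Proof. by move=> hg hf a x y; rewrite hf hg. Qed.

Lemma h_adm_eps : lin (V := K) (U := k^o) (@heps K).
Proof. by case: (hopfP K) => -[_ _ [h _ _] _ _] _ _ _; exact: h. Qed.

Lemma h_adm_swl (U : lmodType k) (f : K -> K -> U) :
  (forall y, lin (fun x => f x y)) -> (forall x, lin (f x)) ->
  lin (fun x => swl (hcop x) f).
Proof.
move=> h1 h2 c x y; case: (hopfP K) => -[h _ _ _ _] _ _ _.
rewrite /swl h; last by split=> *; [exact: h1 | exact: h2].
rewrite big_cat big_map /= scaler_sumr; congr (_ + _).
by apply: eq_bigr => p _; rewrite (linZ _ _ (h1 _)).
Qed.

Lemma h_swl_assoc (U : lmodType k) (f : K -> K -> K -> U) :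
  (forall y z, lin (fun x => f x y z)) -> (forall x z, lin (fun y => f x y z)) ->
  (forall x y, lin (f x y)) ->
  forall x, swl (hcop x) (fun y z => swl (hcop y) (fun u v => f u v z)) =
            swl (hcop x) (fun y z => swl (hcop z) (fun u v => f y u v)).
Proof.
move=> h1 h2 h3 x; case: (hopfP K) => -[_ h _ _ _] _ _ _.
have hf : trilin (V := K) (W := K) (X := K) f.
  by split=> *; [exact: h1 | exact: h2 | exact: h3].
by move: (h x _ _ hf); rewrite big_cop2 big_cop2'.
Qed.

Lemma h_swl_comm (U : lmodType k) (f : K -> K -> U) :
  (forall y, lin (fun x => f x y)) -> (forall x, lin (f x)) ->
  forall x, swl (hcop x) f = swl (hcop x) (fun y z => f z y).
Proof.
move=> h1 h2 x.
have hf : bilin (V := K) (W := K) f by split=> *; [exact: h1 | exact: h2].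
by rewrite /swl (hcocomm x hf) big_map.
Qed.

Lemma h_swl_counit (U : lmodType k) (f : K -> U) : lin f ->
  forall x, swl (hcop x) (fun y z => heps y *: f z) = f x.
Proof.
move=> hf x; case: (hopfP K) => -[_ _ [_ h _] _ _] _ _ _.
rewrite -{2}(h x) lin_sum //; apply: eq_bigr => p _.
by rewrite linZ.
Qed.

Definition co : coalg k :=
  @Coalg k K (fun U => @lin k K U) (@hcop K) (@heps K) h_adm_lin h_adm_comb h_adm_eps
    h_adm_swl h_swl_assoc h_swl_comm h_swl_counit.

End CoalgOf.

End HopfCoalgebras.

Section Permutations.
Variables (k : fieldType) (X : coalg k) (U : lmodType k).

Lemma sw_assocC (f : X -> X -> X -> U) x :
  (forall y z, adm (fun x => f x y z)) -> (forall x z, adm (fun y => f x y z)) ->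
  (forall x y, adm (f x y)) ->
  sw x (fun y z => sw y (fun u v => f u v z)) = sw x (fun y z => sw y (fun u v => f u z v)).
Proof.
move=> h1 h2 h3.
(* The default [0] is never reached: these trees only produce lists of three leaves. The same device
   recurs at every use of [swt_perm]. *)
apply: (@swt_perm _ X U (Nd (Nd Lf Lf) Lf) (Nd (Nd Lf Lf) Lf) [:: 1] x
  (fun l => if l is [:: a; b; c] then f a b c else 0)) => //=.
Qed.

(** Exchange of the middle two of four factors, the form of cocommutativity that makes a convolution
    of coalgebra maps a coalgebra map. *)
Lemma sw_interchange (f : X -> X -> X -> X -> U) x :
  (forall b c d, adm (fun a => f a b c d)) -> (forall a c d, adm (fun b => f a b c d)) ->
  (forall a b d, adm (fun c => f a b c d)) -> (forall a b c, adm (f a b c)) ->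
  sw x (fun y z => sw y (fun a b => sw z (fun c d => f a b c d))) =
  sw x (fun y z => sw y (fun a b => sw z (fun c d => f a c b d))).
Proof.
move=> h1 h2 h3 h4.
apply: (@swt_perm _ X U (Nd (Nd Lf Lf) (Nd Lf Lf)) (Nd (Nd Lf Lf) (Nd Lf Lf)) [:: 1] x
  (fun l => if l is [:: a; b; c; d] then f a b c d else 0)) => //=.
Qed.

End Permutations.

(** * Points of Hopf algebras *)

Section Points.
Variable k : fieldType.

Record pt (X : coalg k) (K : chopf k) := Pt {
  pfun :> X -> K;
  pt_adm : adm pfun;
  pt_cop : forall (U : lmodType k) (f : K -> K -> U), bilin f -> forall x,
    sw (pfun x : co K) f = sw x (fun y z => f (pfun y) (pfun z));
  pt_eps : forall x, heps (pfun x) = ceps x }.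

(** With extensionality and proof irrelevance the points satisfy the group laws for plain [=], so
    the abstract group theorem applies to them directly. *)
Lemma pt_eq (X : coalg k) (K : chopf k) (p q : pt X K) : (forall x, p x = q x) -> p = q.
Proof.
case: p q => [p p1 p2 p3] [q q1 q2 q3] /= /functional_extensionality e.
by subst q; rewrite (proof_irrelevance _ p1 q1) (proof_irrelevance _ p2 q2)
  (proof_irrelevance _ p3 q3).
Qed.

(** Coalgebra maps from the tensor product of [K] and [L] to [M]. The products and both actions are
    of this kind, so convolution is treated once for all of them. *)
Record bmap (K L M : chopf k) := BMap {
  bfun :> K -> L -> M;
  bmap_bilin : bilin bfun;
  bmap_cop : forall (U : lmodType k) (f : M -> M -> U), bilin f -> forall x y,
    sw (bfun x y : co M) f =
    sw (x : co K) (fun a b => sw (y : co L) (fun c d => f (bfun a c) (bfun b d)));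
  bmap_eps : forall x y, heps (bfun x y) = heps x * heps y }.

Lemma lin_swh (K : chopf k) (U : lmodType k) (f : K -> K -> U) :
  bilin f -> lin (fun x : K => sw (x : co K) f).
Proof.
move=> [h1 h2]; apply: (@adm_sw _ (co K)) => [y | x] c u v; [exact: h1 | exact: h2].
Qed.

Lemma adm_pt (X : coalg k) (K : chopf k) (p : pt X K) (U : lmodType k) (f : K -> U) :
  lin f -> adm (fun x => f (p x)).
Proof. by move=> hf; apply: adm_lin (pt_adm p). Qed.

Section Comp.
Variables (X : coalg k) (K L : chopf k) (q : pt (co K) L) (p : pt X K).

Lemma pcompose_adm : adm (fun x => q (p x)).
Proof. apply: adm_pt; exact: (pt_adm q). Qed.

Lemma pcompose_cop (U : lmodType k) (f : L -> L -> U) : bilin f -> forall x,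
  sw (q (p x) : co L) f = sw x (fun y z => f (q (p y)) (q (p z))).
Proof.
move=> hf x; rewrite pt_cop // (@pt_cop _ _ p _ (fun y z => f (q y) (q z))) //.
case: hf => h1 h2; split=> c u v w.
  by rewrite (pt_adm q) h1.
by rewrite (pt_adm q) h2.
Qed.

Lemma pcompose_eps x : heps (q (p x)) = ceps x.
Proof. by rewrite pt_eps [ceps _]pt_eps. Qed.

Definition pcompose : pt X L := Pt pcompose_adm pcompose_cop pcompose_eps.

End Comp.

Section Conv.
Variables (X : coalg k) (K L M : chopf k) (m : bmap K L M).
Variables (p : pt X K) (q : pt X L).

Definition conv (x : X) : M := sw x (fun y z => m (p y) (q z)).

Lemma conv_adm : adm conv.
Proof.
apply: adm_sw => [y | x].
  exact: (adm_bl _ (bmap_bilin m) (pt_adm p)).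
exact: (adm_br _ (bmap_bilin m) (pt_adm q)).
Qed.

(** Comultiplying the value puts [x1, x3] in one tensor factor and [x2, x4] in the other, while
    convolving twice puts [x1, x2] against [x3, x4]; [sw_interchange] reconciles the two. *)
Lemma conv_cop (U : lmodType k) (f : M -> M -> U) : bilin f -> forall x,
  sw (conv x : co M) f = sw x (fun y z => f (conv y) (conv z)).
Proof.
move=> hf x; rewrite /conv [LHS](lin_sw _ _ (lin_swh hf)).
have hm := bmap_bilin m; have hp := pt_adm p; have hq := pt_adm q.
transitivity (sw x (fun y z => sw y (fun a b => sw z (fun c d =>
    f (m (p a) (q c)) (m (p b) (q d)))))).
  apply: eq_sw => y z; rewrite bmap_cop //.
  rewrite (@pt_cop _ _ p _ (fun a b => sw (q z : co L) (fun c d => f (m a c) (m b d)))).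
    apply: eq_sw => a b; rewrite (@pt_cop _ _ q _ (fun c d => f (m (p a) c) (m (p b) d))) //.
    split=> e u v w.
      by rewrite (bilin_linr _ hm) (bilin_linl _ hf).
    by rewrite (bilin_linr _ hm) (bilin_linr _ hf).
  split=> e u v w.
    rewrite (@adm_sw_par _ (co K) (co L) U (q z) (fun u c d => f (m u c) (m w d))) // => c d.
    by move=> e' u' v'; rewrite (bilin_linl _ hm) (bilin_linl _ hf).
  rewrite (@adm_sw_par _ (co K) (co L) U (q z) (fun v c d => f (m u c) (m v d))) // => c d.
  by move=> e' u' v'; rewrite (bilin_linl _ hm) (bilin_linr _ hf).
rewrite (@sw_interchange _ _ _ (fun a b c d => f (m (p a) (q c)) (m (p b) (q d)))).
- apply: eq_sw => y z.
  rewrite (lin_sw _ _ (bilin_linl _ hf)); apply: eq_sw => a b.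
  by rewrite (lin_sw _ _ (bilin_linr _ hf)).
all: by move=> *; admt.

Qed.

Lemma conv_eps x : heps (conv x) = ceps x.
Proof.
rewrite /conv (@lin_sw _ X M k^o (@heps k M)); last exact: h_adm_eps.
rewrite -[RHS](sw_counitl x (adm_ceps X)).
by apply: eq_bigr => -[y z] _; rewrite bmap_eps !pt_eps.
Qed.

Definition pconv : pt X M := Pt conv_adm conv_cop conv_eps.

End Conv.

End Points.

(** * Antipode, product and unit as maps of coalgebras *)

Section HopfIdentities.
Variables (k : fieldType) (K : chopf k).
Implicit Types U : lmodType k.

Lemma hepsM (x y : K) : heps (x * y) = heps x * heps y.
Proof. by case: (hopfP K) => -[_ _ _ _ [h _]] _ _ _; apply: h. Qed.

Lemma heps1 : heps (1 : K) = 1.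
Proof. by case: (hopfP K) => -[_ _ _ _ [_ h]] _ _ _. Qed.

Lemma hepsZ (c : k) (x : K) : heps (c *: x) = c * heps x.
Proof. exact: (linZ c x (h_adm_eps (K := K))). Qed.

Lemma sw_mul U (f : K -> K -> U) : bilin f -> forall x y : K,
  sw (x * y : co K) f =
  sw (x : co K) (fun a b => sw (y : co K) (fun c d => f (a * c) (b * d))).
Proof.
move=> hf x y; case: (hopfP K) => -[_ _ _ [h _] _] _ _ _.
by rewrite /sw /swl (h x y _ _ hf) big_allpairs_dep.
Qed.

Lemma sw_1 U (f : K -> K -> U) : bilin f -> sw (1 : co K) f = f 1 1.
Proof.
move=> hf; case: (hopfP K) => -[_ _ _ [_ h] _] _ _ _.
by rewrite /sw /swl (h _ _ hf) big_seq1.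
Qed.

Lemma lin_S : lin (@hS _ K).
Proof. by case: (hopfP K). Qed.

Lemma antipodel (x : K) : sw (x : co K) (fun y z => hS y * z) = heps x *: 1.
Proof. by case: (hopfP K) => _ _ h _; exact: h. Qed.

Lemma antipoder (x : K) : sw (x : co K) (fun y z => y * hS z) = heps x *: 1.
Proof. by case: (hopfP K) => _ _ _ h; exact: h. Qed.

Lemma sw_counitr (X : coalg k) U (f : X -> U) (x : X) :
  adm f -> sw x (fun y z => ceps z *: f y) = f x.
Proof.
move=> hf; rewrite sw_comm; first exact: sw_counitl.
  by move=> y; apply: adm_scale.
by move=> y; apply: adm_ceps_scale.
Qed.

(** The multiplicative counit is applied to the antipode law, and the counit law then absorbs
    [eps x2]. *)
Lemma S_eps (x : K) : heps (hS x) = heps x.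
Proof.
have := congr1 (@heps _ K) (antipodel x).
rewrite hepsZ heps1 mulr1 (@lin_sw _ (co K) K k^o (@heps _ K)); last exact: h_adm_eps.
move=> <-.
rewrite -[LHS](@sw_counitr (co K) k^o (fun y => heps (hS y))); last first.
  exact: (h_adm_lin (h_adm_eps (K := K)) lin_S).
by apply: eq_bigr => -[y z] _; rewrite hepsM mulrC.
Qed.

(* Both sides are computed from [S x1 x2 S x4 (x) S x1 x3 S x5]
   (comultiplying the first factor), where cocommutativity allows either
   [x1, x2, x3] or [x2, x4] and [x3, x5] to be contracted first. *)
Lemma S_cop U (f : K -> K -> U) : bilin f -> forall x : K,
  sw (hS x : co K) f = sw (x : co K) (fun y z => f (hS y) (hS z)).
Proof.
move=> hf x.
pose E (s u v : K) := sw (s : co K) (fun s1 s2 => f (s1 * u) (s2 * v)).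
have hm := bilin_mul K; have linS := lin_S.
have fl a : lin (f^~ a) by exact: bilin_linl.
have fr a : lin (f a) by exact: bilin_linr.
have E1 u v : lin (fun s => E s u v).
  apply: lin_swh; split=> c a b y.
    by rewrite (bilin_linl _ hm) (bilin_linl _ hf).
  by rewrite (bilin_linl _ hm) (bilin_linr _ hf).
have E2 s v : lin (fun u => E s u v).
  apply: (@adm_sw_par _ (co K) (co K) U s (fun u s1 s2 => f (s1 * u) (s2 * v))) => s1 s2 c a b.
  by rewrite (bilin_linr _ hm) (bilin_linl _ hf).
have E3 s u : lin (fun v => E s u v).
  apply: (@adm_sw_par _ (co K) (co K) U s (fun v s1 s2 => f (s1 * u) (s2 * v))) => s1 s2 c a b.
  by rewrite (bilin_linr _ hm) (bilin_linr _ hf).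
pose g a b c d e := E (hS a) (b * hS c) (d * hS e).
have g1 b c d e : lin (fun a => g a b c d e) by apply: h_adm_lin (E1 _ _) linS.
have g2 a c d e : lin (fun b => g a b c d e).
  exact: (h_adm_lin (K := K) (E2 _ _) (bilin_linl _ hm)).
have g3 a b d e : lin (fun c => g a b c d e).
  exact: (h_adm_lin (K := K) (E2 _ _) (h_adm_lin (K := K) (bilin_linr _ hm) linS)).
have g4 a b c e : lin (fun d => g a b c d e).
  exact: (h_adm_lin (K := K) (E3 _ _) (bilin_linl _ hm)).
have g5 a b c d : lin (g a b c d).
  exact: (h_adm_lin (K := K) (E3 _ _) (h_adm_lin (K := K) (bilin_linr _ hm) linS)).
transitivity (sw (x : co K) (fun y z => sw (z : co K) (fun u v =>
    sw (u : co K) (fun u1 u2 => sw (v : co K) (fun v1 v2 => g y u1 u2 v1 v2))))).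
  rewrite -[LHS](@sw_counitr (co K) U (fun y => sw (hS y : co K) f)); last first.
    exact: (h_adm_lin (K := K) (lin_swh hf) linS).
  apply: eq_sw => y z.
  rewrite -[LHS](@sw_counitl _ (co K) U (fun v => heps v *: sw (hS y : co K) f)); last first.
    exact: (@adm_ceps_scale _ (co K) _ _).
  apply: eq_sw => u v.
  transitivity (E (hS y) (heps u *: 1) (heps v *: 1)).
    rewrite (linZ _ _ (E2 _ _)) (linZ _ _ (E3 _ _)); do 2 congr (_ *: _).
    by apply: eq_sw => s1 s2; rewrite !mulr1.
  rewrite -!antipoder (@lin_sw _ (co K) K U (fun w => E (hS y) w _)) //.
  by apply: eq_sw => u1 u2; rewrite (@lin_sw _ (co K) K U (E (hS y) _)).
transitivity (sw (x : co K) (fun y z => sw (y : co K) (fun a b => sw (b : co K) (fun b1 b2 =>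
    sw (z : co K) (fun c d => g a b1 c b2 d))))).
  apply: (@swt_perm _ (co K) U (Nd Lf (Nd (Nd Lf Lf) (Nd Lf Lf)))
    (Nd (Nd Lf (Nd Lf Lf)) (Nd Lf Lf)) [:: 2] x
    (fun l => if l is [:: a; b; c; d; e] then g a b c d e else 0)) => //=.
have gE : lin (fun z => sw (z : co K) (fun c d => f (hS c) (hS d))).
  apply: (@adm_sw _ (co K)) => w; first exact: (h_adm_lin (K := K) (fl (hS w)) linS).
  exact: (h_adm_lin (K := K) (fr (hS w)) linS).
rewrite -[RHS](@sw_counitl _ (co K) U _ x gE); apply: eq_sw => y z.
pose Q u v := sw (z : co K) (fun c d => f (u * hS c) (v * hS d)).
have hQ : bilin Q.
  split=> c u v w; first apply: (@adm_sw_par _ (co K) (co K) U z (fun u c d => f (u * hS c) (w * hS d))) => {c} {u} {v} c d r u v.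
    by rewrite (bilin_linl _ hm) fl.
  apply: (@adm_sw_par _ (co K) (co K) U z (fun v c d => f (u * hS c) (v * hS d))) => {c} {v} {w} c d r w v.
  by rewrite (bilin_linl _ hm) fr.
transitivity (sw (y : co K) (fun a b => sw (hS a * b : co K) Q)).
  apply: eq_sw => a b; rewrite sw_mul // [RHS]sw_exch; apply: eq_sw => b1 b2.
  by rewrite /Q [RHS]sw_exch; apply: eq_sw => c d; apply: eq_sw => s1 s2; rewrite !mulrA.
rewrite -(@lin_sw _ (co K) K U (fun w => sw (w : co K) Q)); last exact: lin_swh.
rewrite antipodel (linZ _ _ (lin_swh hQ)) sw_1 //; congr (_ *: _).
by apply: eq_sw => c d; rewrite !mul1r.
Qed.

Lemma lin_hepsZ (V : lmodType k) (v : V) : lin (fun x : K => heps x *: v).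
Proof. exact: (@adm_ceps_scale _ (co K) _ _). Qed.

(** Composition with this point is the inverse of the convolution group; cocommutativity is what
    makes the antipode a coalgebra map rather than an anti-map. *)
Definition S_pt : pt (co K) K := @Pt _ (co K) K _ lin_S S_cop S_eps.

Definition mul_bmap : bmap K K K := BMap (bilin_mul K) sw_mul hepsM.

Section One.
Variable X : coalg k.

Lemma one_adm : adm (fun x : X => ceps x *: 1 : K).
Proof. exact: adm_ceps_scale. Qed.

Lemma one_cop U (f : K -> K -> U) : bilin f -> forall x : X,
  sw (ceps x *: 1 : co K) f = sw x (fun y z => f (ceps y *: 1) (ceps z *: 1)).
Proof.
move=> hf x; rewrite (linZ _ _ (lin_swh hf)) sw_1 //.
rewrite -[LHS](@sw_counitl _ X U (fun z => ceps z *: f 1 1)); last exact: adm_ceps_scale.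
by apply: eq_sw => y z; rewrite (linZ _ _ (bilin_linl _ hf)) (linZ _ _ (bilin_linr _ hf)).
Qed.

Lemma one_eps (x : X) : heps (ceps x *: 1 : K) = ceps x.
Proof. by rewrite hepsZ heps1 mulr1. Qed.

Definition pone : pt X K := Pt one_adm one_cop one_eps.

End One.

End HopfIdentities.

Ltac admp := first
  [ assumption
  | exact: pt_adm
  | apply: adm_bl; [first [exact: bmap_bilin | bil] | admp]
  | apply: adm_br; [first [exact: bmap_bilin | bil] | admp]
  | exact: adm_ceps_scale
  | apply: adm_scale; admp ].

(** * Group laws and actions on points *)

Section PointLaws.
Variables (k : fieldType) (X : coalg k).

(** Four unrelated pairings are allowed in order to cover both associativity of products and the law
    of the left action. *)
Lemma pconv_assoc (K1 K2 K3 L L' M : chopf k) (m1 : bmap K1 K2 L) (m2 : bmap L K3 M)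
    (n1 : bmap K2 K3 L') (n2 : bmap K1 L' M) (p : pt X K1) (q : pt X K2) (r : pt X K3) :
  (forall a b c, m2 (m1 a b) c = n2 a (n1 b c)) ->
  pconv m2 (pconv m1 p q) r = pconv n2 p (pconv n1 q r).
Proof.
move=> h; apply: pt_eq => x.
transitivity (sw x (fun y z => sw y (fun u v => m2 (m1 (p u) (q v)) (r z)))).
  by apply: eq_sw => y z; rewrite -(lin_sw _ _ (bilin_linl _ (bmap_bilin m2))).
rewrite (@sw_assoc _ _ _ (fun u v z => m2 (m1 (p u) (q v)) (r z))); try by move=> *; admp.
apply: eq_sw => y z; rewrite [RHS](lin_sw _ _ (bilin_linr _ (bmap_bilin n2))).
by apply: eq_sw => u v; rewrite h.
Qed.

(** A right action written with the acting element first reverses products; the required exchange of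
    the first two Sweedler factors is granted by cocommutativity of [X]. *)
Lemma pconv_antiassoc (K1 K2 K3 L L' M : chopf k) (m1 : bmap K1 K2 L) (m2 : bmap L K3 M)
    (n1 : bmap K1 K3 L') (n2 : bmap K2 L' M) (p : pt X K1) (q : pt X K2) (r : pt X K3) :
  (forall a b c, m2 (m1 a b) c = n2 b (n1 a c)) ->
  pconv m2 (pconv m1 p q) r = pconv n2 q (pconv n1 p r).
Proof.
move=> h; apply: pt_eq => x.
transitivity (sw x (fun y z => sw y (fun u v => m2 (m1 (p u) (q v)) (r z)))).
  by apply: eq_sw => y z; rewrite -(lin_sw _ _ (bilin_linl _ (bmap_bilin m2))).
transitivity (sw x (fun y z => sw z (fun u v => m2 (m1 (p u) (q y)) (r v)))).
  apply: (@swt_perm _ X M (Nd (Nd Lf Lf) Lf) (Nd Lf (Nd Lf Lf)) [:: 0%N] x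
    (fun l => if l is [:: a; b; c] then m2 (m1 (p a) (q b)) (r c) else 0)) => //=.
  by do !split=> * //; admp.
apply: eq_sw => y z; rewrite [RHS](lin_sw _ _ (bilin_linr _ (bmap_bilin n2))).
by apply: eq_sw => u v; rewrite h.
Qed.

Lemma pconv_leftcomm (K1 K2 K3 L L' M : chopf k) (m1 : bmap K1 L M) (m2 : bmap K2 K3 L)
    (n1 : bmap K2 L' M) (n2 : bmap K1 K3 L') (p : pt X K1) (q : pt X K2) (r : pt X K3) :
  (forall a b c, m1 a (m2 b c) = n1 b (n2 a c)) ->
  pconv m1 p (pconv m2 q r) = pconv n1 q (pconv n2 p r).
Proof.
move=> h; apply: pt_eq => x.
transitivity (sw x (fun y z => sw z (fun u v => m1 (p y) (m2 (q u) (r v))))).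
  by apply: eq_sw => y z; rewrite -(lin_sw _ _ (bilin_linr _ (bmap_bilin m1))).
transitivity (sw x (fun y z => sw z (fun u v => m1 (p u) (m2 (q y) (r v))))).
  apply: (@swt_perm _ X M (Nd Lf (Nd Lf Lf)) (Nd Lf (Nd Lf Lf)) [:: 0%N] x
    (fun l => if l is [:: a; b; c] then m1 (p a) (m2 (q b) (r c)) else 0)) => //=.
  by do !split=> * //; admp.
apply: eq_sw => y z; rewrite [RHS](lin_sw _ _ (bilin_linr _ (bmap_bilin n1))).
by apply: eq_sw => u v; rewrite h.
Qed.

(** As [p] is a coalgebra map, the coproduct in the hypothesis is taken in [X] instead of [K]; after
    [sw_interchange] an element acting through its coproduct acts on points by endomorphisms. *)
Lemma pconv_distr (K A : chopf k) (m : bmap K A A) (p : pt X K) (q r : pt X A) :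
  (forall a b c, m a (b * c) = sw (a : co K) (fun a1 a2 => m a1 b * m a2 c)) ->
  pconv m p (pconv (mul_bmap A) q r) =
  pconv (mul_bmap A) (pconv m p q) (pconv m p r).
Proof.
move=> h; apply: pt_eq => x.
transitivity (sw x (fun y z => sw y (fun a b => sw z (fun c d =>
    m (p a) (q c) * m (p b) (r d))))).
  apply: eq_sw => y z; rewrite [LHS](lin_sw _ _ (bilin_linr _ (bmap_bilin m))).
  rewrite sw_exch; apply: eq_sw => c d; rewrite h.
  rewrite (@pt_cop _ _ _ p _ (fun a b => m a (q c) * m b (r d))) //.
  have hm := bmap_bilin m; have hM := bilin_mul A; split=> e u v w.
    by rewrite (bilin_linl _ hm) (bilin_linl _ hM).
  by rewrite (bilin_linl _ hm) (bilin_linr _ hM).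
rewrite (@sw_interchange _ _ _ (fun a b c d => m (p a) (q c) * m (p b) (r d)));
  try by move=> *; admp.
apply: eq_sw => y z; rewrite [RHS](lin_sw _ _ (bilin_linl _ (bilin_mul A))).
by apply: eq_sw => a b; rewrite [RHS](lin_sw _ _ (bilin_linr _ (bilin_mul A))).
Qed.

Lemma pconv_onel (K A : chopf k) (m : bmap K A A) (q : pt X A) :
  (forall a, m 1 a = a) -> pconv m (pone K X) q = q.
Proof.
move=> h; apply: pt_eq => x; rewrite -[RHS](sw_counitl x (pt_adm q)).
by apply: eq_sw => y z; rewrite (linZ _ _ (bilin_linl _ (bmap_bilin m))) h.
Qed.

Lemma pmul_onel (A : chopf k) (q : pt X A) : pconv (mul_bmap A) (pone A X) q = q.
Proof. by apply: pconv_onel => a; apply: mul1r. Qed.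

Lemma pmul_oner (A : chopf k) (q : pt X A) : pconv (mul_bmap A) q (pone A X) = q.
Proof.
apply: pt_eq => x; rewrite -[RHS](sw_counitr x (pt_adm q)).
by apply: eq_sw => y z /=; rewrite -scalerAr mulr1.
Qed.

Lemma pmulA (A : chopf k) (p q r : pt X A) :
  pconv (mul_bmap A) p (pconv (mul_bmap A) q r) = pconv (mul_bmap A) (pconv (mul_bmap A) p q) r.
Proof. by symmetry; apply: pconv_assoc => a b c; rewrite /= mulrA. Qed.

Lemma pmulV (A : chopf k) (q : pt X A) :
  pconv (mul_bmap A) (pcompose (S_pt A) q) q = pone A X.
Proof.
apply: pt_eq => x /=; rewrite -(pt_eps q) -antipodel.
rewrite (@pt_cop _ _ _ q _ (fun a b => hS a * b)) //.
have hm := bilin_mul A; split=> c u v w; first by rewrite lin_S (bilin_linl _ hm).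
by rewrite (bilin_linr _ hm).
Qed.

Lemma pmulVr (A : chopf k) (q : pt X A) :
  pconv (mul_bmap A) q (pcompose (S_pt A) q) = pone A X.
Proof.
apply: pt_eq => x /=; rewrite -(pt_eps q) -antipoder.
rewrite (@pt_cop _ _ _ q _ (fun a b => a * hS b)) //.
have hm := bilin_mul A; split=> c u v w; first by rewrite (bilin_linl _ hm).
by rewrite lin_S (bilin_linr _ hm).
Qed.

Lemma pcompose_pconv (K L M N : chopf k) (m : bmap K L M) (f : pt (co M) N)
    (p : pt X K) (q : pt X L) x :
  pcompose f (pconv m p q) x = sw x (fun y z => f (m (p y) (q z))).
Proof. by rewrite /= (lin_sw _ _ (pt_adm f)). Qed.

End PointLaws.

(** * The statement for groups *)

(* [L] and [Q] are the left and right actions of [G] on [N]. *)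
Section Groups.
Variables (G N : Type).
Variables (mulG : G -> G -> G) (oneG : G) (invG : G -> G).
Variables (mulN : N -> N -> N) (oneN : N) (invN : N -> N).
Variables (L Q : G -> N -> N) (B : G -> G) (R : N -> N).
Local Notation "x * y" := (mulG x y).
Local Notation "x ^-1" := (invG x).
Local Notation "a ** b" := (mulN a b) (at level 40, left associativity).

Hypothesis mulGA : associative mulG.
Hypothesis mul1G : left_id oneG mulG.
Hypothesis mulG1 : right_id oneG mulG.
Hypothesis mulVG : left_inverse oneG invG mulG.
Hypothesis mulGV : right_inverse oneG invG mulG.
Hypothesis mulNA : associative mulN.
Hypothesis mul1N : left_id oneN mulN.
Hypothesis mulN1 : right_id oneN mulN.
Hypothesis mulVN : left_inverse oneN invN mulN.
Hypothesis mulNV : right_inverse oneN invN mulN.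
Hypothesis L1 : forall a, L oneG a = a.
Hypothesis LM : forall h g a, L (h * g) a = L h (L g a).
Hypothesis Q1 : forall a, Q oneG a = a.
Hypothesis QM : forall h g a, Q (h * g) a = Q g (Q h a).
Hypothesis LQ : forall h g a, Q g (L h a) = L h (Q g a).
Hypothesis LD : forall h a b, L h (a ** b) = L h a ** L h b.
Hypothesis QD : forall h a b, Q h (a ** b) = Q h a ** Q h b.
Hypothesis Bq : forall x y, B x * B y = B (x * B x * y * (B x)^-1).

(** [A]-component of [Bbar x * Bbar y] for [x = a # h] and [y = b # g]; the [H]-component is
    [B h * B g]. *)
Definition lhs_act (a b : N) (h g : G) : N :=
  Q (B g) (Q (B h) (L (B h) (R a))) ** L (B h) (Q (B g) (L (B g) (R b))).

(* [A]-component of [(x * Bbar x * y) * S (Bbar x)] for [x = a # h], [y = b # g]. *)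
Definition arg_act (a b : N) (h g : G) : N :=
  let p := B h in let u := Q p (L p (R a)) in
  Q p^-1 (Q g (Q p a ** L h u) ** L (h * p) b) **
  L (h * p * g) (L p^-1 (Q p^-1 (invN u))).

(** [H]-component of the same argument. By [Bq] its image under [B] is [B h * B g], so only
    [A]-components remain to be compared. *)
Definition arg_grp (h g : G) : G := h * B h * g * (B h)^-1.

Definition rhs_act (a b : N) (h g : G) : N :=
  let q := B (arg_grp h g) in Q q (L q (R (arg_act a b h g))).

Lemma invN_uniq a b : a ** b = oneN -> b = invN a.
Proof. by move=> h; rewrite -[b]mul1N -(mulVN a) -mulNA h mulN1. Qed.

Lemma idemG x : x * x = x -> x = oneG.
Proof. by move=> h; rewrite -[x]mul1G -(mulVG x) -mulGA h mulVG. Qed.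

Lemma idemN x : x ** x = x -> x = oneN.
Proof. by move=> h; rewrite -[x]mul1N -(mulVN x) -mulNA h mulVN. Qed.

Lemma L_1 h : L h oneN = oneN.
Proof. by apply: idemN; rewrite -LD mul1N. Qed.

Lemma Q_1 h : Q h oneN = oneN.
Proof. by apply: idemN; rewrite -QD mul1N. Qed.

Lemma LV h a : L h (invN a) = invN (L h a).
Proof. by apply: invN_uniq; rewrite -LD mulNV L_1. Qed.

Lemma QV h a : Q h (invN a) = invN (Q h a).
Proof. by apply: invN_uniq; rewrite -QD mulNV Q_1. Qed.

(** At the identity the argument in [Bq] collapses to [oneG], so [B oneG] is idempotent. *)
Lemma B_1 : B oneG = oneG.
Proof. by apply: idemG; rewrite Bq mul1G mulG1 mulGV. Qed.

Lemma inv_1 : oneG^-1 = oneG.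
Proof. by rewrite -[LHS]mul1G mulGV. Qed.

Lemma LK h a : L h (L h^-1 a) = a. Proof. by rewrite -LM mulGV L1. Qed.
Lemma LKV h a : L h^-1 (L h a) = a. Proof. by rewrite -LM mulVG L1. Qed.
Lemma QK h a : Q h (Q h^-1 a) = a. Proof. by rewrite -QM mulVG Q1. Qed.
Lemma QKV h a : Q h^-1 (Q h a) = a. Proof. by rewrite -QM mulGV Q1. Qed.

Definition RB_cond1 := forall a b h,
  R (Q h (a ** R a) ** b ** L h (invN (R a))) = L (B h)^-1 (R a) ** R b.

Definition RB_cond2 := forall b g,
  R (Q (B g)^-1 (L (g * B g) b)) = Q (B g)^-1 (R b).

Definition RB_cond := forall a b h g, lhs_act a b h g = rhs_act a b h g.

(** In the last factor of [arg_act] the two actions by [p] inside [u] cancel those by its inverse;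
    the rest is distributivity and commutation of the actions. *)
Lemma arg_actE a b h g : let p := B h in
  arg_act a b h g = Q p^-1 (Q g (Q p a)) ** Q p^-1 (Q g (Q p (L (h * p) (R a))))
    ** Q p^-1 (L (h * p) b) ** L (h * p * g) (invN (R a)).
Proof.
rewrite /arg_act !QD -!QV -!LV QKV LKV; congr (_ ** _ ** _ ** _).
by rewrite LM !LQ.
Qed.

(** Both sides carry the left and the right action of [B h * B g], on the left-hand side after
    inserting inverses. These actions are invertible and can be stripped. *)
Lemma RB_cond_reduce a b h g : lhs_act a b h g = rhs_act a b h g <->
  R (arg_act a b h g) = L (B g)^-1 (R a) ** Q (B h)^-1 (R b).
Proof.
have -> : rhs_act a b h g = L (B h) (L (B g) (Q (B g) (Q (B h) (R (arg_act a b h g))))).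
  by rewrite /rhs_act /arg_grp -Bq QM LM !LQ.
have -> : lhs_act a b h g = L (B h) (L (B g) (Q (B g) (Q (B h)
    (L (B g)^-1 (R a) ** Q (B h)^-1 (R b))))).
  rewrite !QD !LD QK /lhs_act; congr (_ ** _); last by rewrite !LQ.
  by rewrite !LQ LK.
split=> [e|->] //.
have {}e := congr1 (fun a => Q (B h)^-1 (Q (B g)^-1 (L (B g)^-1 (L (B h)^-1 a)))) e.
by move: e; rewrite /= !LKV !QKV => ->.
Qed.

Theorem group_RB : RB_cond <-> RB_cond1 /\ RB_cond2.
Proof.
split=> [H | [C1 C2] a b h g].
  have E a b h g := proj1 (RB_cond_reduce a b h g) (H a b h g).
  have C1 : RB_cond1.
    move=> a b h; have := E a b oneG h.
    by rewrite arg_actE B_1 inv_1 !mul1G !L1 !Q1 QD.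
  (* Putting [a = oneN] requires the value of [R] there; the first condition at identities makes
     [R oneN] idempotent. *)
  split=> // b g; have R1 : R oneN = oneN.
    apply: idemN; have := C1 oneN oneN oneG.
    by rewrite B_1 inv_1 L1 Q1 mulN1 mul1N L1 mulNV => <-.
  have := E oneN b g oneG.
  rewrite arg_actE R1 !L_1 !Q_1 mul1N mul1N.
  by rewrite -[invN oneN]mul1N mulNV L_1 mulN1 mul1N => ->.
apply/RB_cond_reduce; set p := B h.
pose a' := Q p (L (h * p)^-1 a).
have Ra : R a = Q p^-1 (R a') by rewrite -C2 /a' -/p !LQ LK QKV.
have -> : L (B g)^-1 (R a) ** Q p^-1 (R b) = Q p^-1 (L (B g)^-1 (R a') ** R b).
  by rewrite QD LQ -Ra.
rewrite -C1 -C2 -/p; congr R; rewrite arg_actE -/p !(LD, QD).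
have -> : R a' = Q p (R a) by rewrite Ra QK.
congr (_ ** _ ** _ ** _).
- by rewrite /a' !LQ LK.
- by rewrite !LQ.
- by rewrite (LM (h * p)) -QV !LQ QKV.
Qed.

End Groups.

(** * Pulling points back to product coalgebras *)

Section Lifts.
Variables (k : fieldType) (X Y : coalg k).
Implicit Types U : lmodType k.

(** The two projections of a product coalgebra convolve to the identity: [ceps u.2] and [ceps v.1]
    absorb the discarded halves. *)
Lemma sw_lr U (f : X -> Y -> U) (z : prodC X Y) :
  (forall v, adm (fun u => f u v)) -> (forall u, adm (f u)) ->
  sw z (fun u v => ceps u.2 *: (ceps v.1 *: f u.1 v.2)) = f z.1 z.2.
Proof.
move=> h1 h2; rewrite sw_prod /= -[RHS](sw_counitr z.1 (h1 z.2)); apply: eq_sw => a b.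
by rewrite -(sw_counitl z.2 (adm_scale (ceps b) (h2 a))).
Qed.

Lemma sw_ll U (f : X -> X -> U) (z : prodC X Y) :
  sw z (fun u v => ceps u.2 *: (ceps v.2 *: f u.1 v.1)) = ceps z.2 *: sw z.1 f.
Proof.
rewrite sw_prod /= (lin_sw _ _ (bilin_linr _ (bilin_scale U))); apply: eq_sw => a b.
by rewrite -[RHS](sw_counitl z.2 (@adm_ceps_scale _ Y U (f a b))).
Qed.

Lemma sw_rr U (f : Y -> Y -> U) (z : prodC X Y) :
  sw z (fun u v => ceps u.1 *: (ceps v.1 *: f u.2 v.2)) = ceps z.1 *: sw z.2 f.
Proof.
rewrite sw_prod /= -[RHS](sw_counitl z.1 (@adm_ceps_scale _ X U (sw z.2 f))).
apply: eq_sw => a b.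
rewrite (lin_sw _ _ (bilin_linr _ (bilin_scale U))).
by rewrite (lin_sw _ _ (bilin_linr _ (bilin_scale U))).
Qed.

Variable K : chopf k.

Lemma liftl_adm (p : pt X K) : adm (fun z : prodC X Y => ceps z.2 *: p z.1).
Proof. by split=> w /=; [apply: adm_scale (pt_adm p) | exact: adm_ceps_scale]. Qed.

Lemma liftl_cop (p : pt X K) U (f : K -> K -> U) : bilin f -> forall z : prodC X Y,
  sw (ceps z.2 *: p z.1 : co K) f =
  sw z (fun u v => f (ceps u.2 *: p u.1) (ceps v.2 *: p v.1)).
Proof.
move=> hf z; rewrite (linZ _ _ (lin_swh hf)) pt_cop // -sw_ll.
by apply: eq_sw => u v; rewrite (linZ _ _ (bilin_linl _ hf)) (linZ _ _ (bilin_linr _ hf)).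
Qed.

Lemma liftl_eps (p : pt X K) (z : prodC X Y) : heps (ceps z.2 *: p z.1) = ceps z.
Proof. by rewrite hepsZ pt_eps mulrC. Qed.

(** Pullback along the first projection, which applies the counit to the second factor. *)
Definition liftl (p : pt X K) : pt (prodC X Y) K :=
  Pt (liftl_adm p) (@liftl_cop p) (liftl_eps p).

Lemma liftr_adm (p : pt Y K) : adm (fun z : prodC X Y => ceps z.1 *: p z.2).
Proof. by split=> w /=; [exact: adm_ceps_scale | apply: adm_scale (pt_adm p)]. Qed.

Lemma liftr_cop (p : pt Y K) U (f : K -> K -> U) : bilin f -> forall z : prodC X Y,
  sw (ceps z.1 *: p z.2 : co K) f =
  sw z (fun u v => f (ceps u.1 *: p u.2) (ceps v.1 *: p v.2)).
Proof.
move=> hf z; rewrite (linZ _ _ (lin_swh hf)) pt_cop // -sw_rr.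
by apply: eq_sw => u v; rewrite (linZ _ _ (bilin_linl _ hf)) (linZ _ _ (bilin_linr _ hf)).
Qed.

Lemma liftr_eps (p : pt Y K) (z : prodC X Y) : heps (ceps z.1 *: p z.2) = ceps z.
Proof. by rewrite hepsZ pt_eps. Qed.

Definition liftr (p : pt Y K) : pt (prodC X Y) K :=
  Pt (liftr_adm p) (@liftr_cop p) (liftr_eps p).

End Lifts.

Section Identity.
Variables (k : fieldType) (K : chopf k).

Lemma id_adm : @adm k (co K) K (fun x => x). Proof. by []. Qed.

Definition pid : pt (co K) K :=
  @Pt k (co K) K (fun x => x) id_adm (fun _ _ _ _ => erefl) (fun _ => erefl).

End Identity.

(** * The smash product *)

Section SmashProduct.
Variables (k : fieldType) (A H : chopf k) (la ra : bmap H A A).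
Variables (R : A -> A) (B : pt (co H) H).
Hypothesis linR : lin R.
Implicit Types U : lmodType k.

Local Notation AH := (prodC (co A) (co H)).
Local Notation ract := (fun a h => ra h a).
Local Notation smul := (smash_mul (@hcop _ H) la ract).
Local Notation sS := (smash_S (@hS _ A) (@hcop _ H) (@hS _ H) la ract).
Local Notation sRB := (smash_RB (@hcop _ H) la ract R B).

(** The operations are studied through their transposes: a function [f] on pure tensors is composed
    with the product ([mulE]), the antipode ([SE]) or [Bbar] ([RE]), so that lists need not be
    compared directly. *)
Definition mulE U (f : AH -> U) (s t : AH) : U :=
  sw (s.2 : co H) (fun h1 h2 => sw (t.2 : co H) (fun g1 g2 =>
    f (ract s.1 g2 * la h1 t.1, h2 * g1))).

Definition SE U (f : AH -> U) (s : AH) : U :=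
  sw (s.2 : co H) (fun y z => sw (y : co H) (fun u v =>
    f (la (hS z) (ract (hS s.1) (hS v)), hS u))).

Definition RE U (f : AH -> U) (s : AH) : U :=
  sw (s.2 : co H) (fun y z => sw (y : co H) (fun u v =>
    f (ract (la (B u) (R s.1)) (B v), B z))).

Lemma sum_smul U (f : AH -> U) l l' :
  \sum_(r <- smul l l') f r = \sum_(s <- l) \sum_(t <- l') mulE f s t.
Proof.
rewrite big_flatten big_allpairs_dep; apply: eq_bigr => s _; apply: eq_bigr => t _.
by rewrite /smash_mul_pure big_allpairs_dep.
Qed.

Lemma sum_sS U (f : AH -> U) l : \sum_(r <- sS l) f r = \sum_(s <- l) SE f s.
Proof.
rewrite big_flatten big_map; apply: eq_bigr => s _.
by rewrite big_map big_cop2.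
Qed.

Lemma sum_sRB U (f : AH -> U) l : \sum_(r <- sRB l) f r = \sum_(s <- l) RE f s.
Proof.
rewrite big_flatten big_map; apply: eq_bigr => s _.
by rewrite big_map big_cop2.
Qed.

Let bl := bmap_bilin la.
Let br := bmap_bilin ra.
Let bA := bilin_mul A.
Let bH := bilin_mul H.

Lemma lin_B : lin B. Proof. exact: (pt_adm B). Qed.

Lemma adm_mulEl U (f : AH -> U) t : adm f -> adm (fun s => mulE f s t).
Proof.
move=> [f1 f2]; split=> s; rewrite /mulE /SE /RE /=.
  apply: (@adm_sw_par _ (co A)) => a b; apply: (@adm_sw_par _ (co A)) => c d.
  apply: (adm_lin (f1 _)).
  exact: (h_adm_lin (K := A) (bilin_linl _ bA) (bilin_linr _ br)).
apply: (@adm_sw _ (co H)) => y; apply: (@adm_sw_par _ (co H)) => c d.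
  apply: (adm_lin (f1 _)).
  exact: (h_adm_lin (K := H) (bilin_linr _ bA) (bilin_linl _ bl)).
by apply: (adm_lin (f2 _)); exact: (bilin_linl _ bH).
Qed.

Lemma adm_mulEr U (f : AH -> U) s : adm f -> adm (mulE f s).
Proof.
move=> [f1 f2]; split=> t; rewrite /mulE /SE /RE /=.
  apply: (@adm_sw_par _ (co A)) => a b; apply: (@adm_sw_par _ (co A)) => c d.
  apply: (adm_lin (f1 _)).
  exact: (h_adm_lin (K := A) (bilin_linr _ bA) (bilin_linr _ bl)).
apply: (@adm_sw_par _ (co H)) => a b; apply: (@adm_sw _ (co H)) => y.
  by apply: (adm_lin (f2 _)); exact: (bilin_linr _ bH).
apply: (adm_lin (f1 _)).
exact: (h_adm_lin (K := H) (bilin_linl _ bA) (bilin_linl _ br)).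
Qed.

Lemma adm_SE U (f : AH -> U) : adm f -> adm (SE f).
Proof.
move=> [f1 f2]; split=> s; rewrite /mulE /SE /RE /=.
  apply: (@adm_sw_par _ (co A)) => a b; apply: (@adm_sw_par _ (co A)) => c d.
  apply: (adm_lin (f1 _)); apply: (h_adm_lin (K := A) (bilin_linr _ bl)).
  exact: (h_adm_lin (K := A) (bilin_linr _ br) (@lin_S _ _)).
apply: (@adm_sw _ (co H)) => y; last first.
  apply: (@adm_sw_par _ (co H)) => c d; apply: (adm_lin (f1 _)).
  exact: (h_adm_lin (K := H) (bilin_linl _ bl) (@lin_S _ _)).
apply: (@adm_sw _ (co H)) => c; first by apply: (adm_lin (f2 _)); exact: lin_S.
apply: (adm_lin (f1 _)); apply: (h_adm_lin (K := H) (bilin_linr _ bl)).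
exact: (h_adm_lin (K := H) (bilin_linl _ br) (@lin_S _ _)).
Qed.

Lemma adm_RE U (f : AH -> U) : adm f -> adm (RE f).
Proof.
move=> [f1 f2]; split=> s; rewrite /mulE /SE /RE /=.
  apply: (@adm_sw_par _ (co A)) => a b; apply: (@adm_sw_par _ (co A)) => c d.
  apply: (adm_lin (f1 _)); apply: (h_adm_lin (K := A) (bilin_linr _ br)).
  exact: (h_adm_lin (K := A) (bilin_linr _ bl) linR).
apply: (@adm_sw _ (co H)) => y; last first.
  by apply: (@adm_sw_par _ (co H)) => c d; apply: (adm_lin (f2 _)); exact: lin_B.
apply: (@adm_sw _ (co H)) => c; last first.
  by apply: (adm_lin (f1 _)); exact: (h_adm_lin (K := H) (bilin_linl _ br) lin_B).
apply: (adm_lin (f1 _)); apply: (h_adm_lin (K := H) (bilin_linr _ br)).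
exact: (h_adm_lin (K := H) (bilin_linl _ bl) lin_B).
Qed.

(** The functions of lists that factor through a linear map out of the tensor product. Their
    stability under precomposition with an operation expresses that the operation is well defined on
    tensors. *)
Definition ladm U (F : seq (A * H) -> U) : Prop :=
  @adm k AH U (fun s => F [:: s]) /\ forall l, F l = \sum_(s <- l) F [:: s].

Lemma ladm_intro U (F : seq (A * H) -> U) (f : AH -> U) :
  adm f -> (forall l, F l = \sum_(s <- l) f s) -> ladm F.
Proof.
move=> hf e; have e1 s : F [:: s] = f s by rewrite e big_seq1.
split=> [|l]; first by rewrite (_ : (fun _ => _) = f) //; apply: functional_extensionality.
by rewrite e; apply: eq_bigr => s _; rewrite e1.
Qed.

Lemma ladm_sum U (f : AH -> U) : adm f -> ladm (fun l => \sum_(s <- l) f s).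
Proof. by move=> hf; apply: (ladm_intro hf). Qed.

Lemma ladm_smull U (F : seq (A * H) -> U) l' : ladm F -> ladm (fun l => F (smul l l')).
Proof.
move=> [h e]; apply: (@ladm_intro _ _ (fun s => \sum_(t <- l') mulE (fun s => F [:: s]) s t)).
  by apply: adm_sum => t; exact: adm_mulEl.
by move=> l; rewrite e sum_smul.
Qed.

Lemma ladm_smulr U (F : seq (A * H) -> U) l' : ladm F -> ladm (fun l => F (smul l' l)).
Proof.
move=> [h e]; apply: (@ladm_intro _ _ (fun t => \sum_(s <- l') mulE (fun s => F [:: s]) s t)).
  by apply: adm_sum => t; exact: adm_mulEr.
by move=> l; rewrite e sum_smul exchange_big.
Qed.

Lemma ladm_sS U (F : seq (A * H) -> U) : ladm F -> ladm (fun l => F (sS l)).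
Proof.
by move=> [h e]; apply: (ladm_intro (adm_SE h)) => l; rewrite e sum_sS.
Qed.

Lemma ladm_sRB U (F : seq (A * H) -> U) : ladm F -> ladm (fun l => F (sRB l)).
Proof.
by move=> [h e]; apply: (ladm_intro (adm_RE h)) => l; rewrite e sum_sRB.
Qed.

(** * Points of the smash product as pairs of points *)

Section Rep.
Variable X : coalg k.

(* [F] represents the point [x |-> u x1 (x) p x2] of the smash product. *)
Definition rep (F : X -> seq (A * H)) (u : pt X A) (p : pt X H) : Prop :=
  forall U (f : AH -> U), adm f -> forall x,
    \sum_(s <- F x) f s = sw x (fun y z => f (u y, p z)).

Lemma rep_ladm U (P : seq (A * H) -> U) F u p x : rep F u p -> ladm P ->
  P (F x) = sw x (fun y z => P [:: (u y, p z)]).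
Proof. by move=> hF [h ->]; rewrite hF. Qed.

Lemma adm_pair U (f : AH -> U) (u : pt X A) (p : pt X H) : adm f ->
  (forall z, adm (fun y => f (u y, p z))) /\ (forall y, adm (fun z => f (u y, p z))).
Proof.
by move=> [f1 f2]; split=> y; [exact: adm_lin (f1 _) (pt_adm u) | exact: adm_lin (f2 _) (pt_adm p)].
Qed.

Lemma rep_adm U (P : seq (A * H) -> U) F u p :
  rep F u p -> ladm P -> adm (fun x => P (F x)).
Proof.
move=> hF hP; rewrite (_ : (fun _ => _) = fun x => sw x (fun y z => P [:: (u y, p z)])).
  by have [h _] := hP; have [h1 h2] := adm_pair u p h; exact: (@adm_sw _ X U (fun y z => P [:: (u y, p z)])).
by apply: functional_extensionality => x; exact: (rep_ladm x hF hP).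
Qed.

(** Every pair of points is represented, which allows an identity between lists to be applied to
    arbitrary points. *)
Lemma rep_pair (u : pt X A) (p : pt X H) :
  rep (fun x => [seq (u q.1, p q.2) | q <- ccop x]) u p.
Proof. by move=> U f hf x; rewrite big_map. Qed.

(** A represented family respects coproducts up to equality of tensors, for the same reason as in
    [conv_cop]. *)
Lemma rep_cop U (f : AH -> AH -> U) F u p x : rep F u p ->
  (forall t, adm (fun s => f s t)) -> (forall s, adm (f s)) ->
  \sum_(s <- F x) sw (s : AH) f =
  sw x (fun y z => \sum_(s <- F y) \sum_(t <- F z) f s t).
Proof.
move=> hF h1 h2; rewrite hF; last exact: adm_sw.
transitivity (sw x (fun y z => sw y (fun a b => sw z (fun c d => f (u a, p c) (u b, p d))))).
  apply: eq_sw => y z; rewrite sw_prod.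
  rewrite (@pt_cop _ _ _ u _ (fun a b => sw (p z : co H) (fun c d => f (a, c) (b, d)))).
    apply: eq_sw => a b; rewrite (@pt_cop _ _ _ p _ (fun c d => f (u a, c) (u b, d))) //.
    by split=> c v w y'; [case: (h1 (u b, y')) => _ h | case: (h2 (u a, v)) => _ h]; apply: h.
  split=> c v w y'.
    apply: (@adm_sw_par _ (co A) (co H) U (p z) (fun v c d => f (v, c) (y', d))) => c' d'.
    by case: (h1 (y', d')).
  apply: (@adm_sw_par _ (co A) (co H) U (p z) (fun w c d => f (v, c) (w, d))) => c' d'.
  by case: (h2 (v, c')).
rewrite (@sw_interchange _ _ _ (fun a b c d => f (u a, p c) (u b, p d))).
- apply: eq_sw => y z; rewrite hF; last by apply: adm_sum.
  by apply: eq_sw => a b; rewrite hF.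
- by move=> b c d; case: (adm_pair u p (h1 (u b, p d))).
- by move=> b c d; case: (adm_pair u p (h2 (u b, p c))).
- by move=> b c d; case: (adm_pair u p (h1 (u c, p d))).
- by move=> b c d; case: (adm_pair u p (h2 (u b, p d))).
Qed.

Definition mulF (F G : X -> seq (A * H)) x : seq (A * H) :=
  flatten [seq smul (F q.1) (G q.2) | q <- ccop x].

Lemma ladm_mulF U (P : seq (A * H) -> U) F G x : ladm P ->
  P (mulF F G x) = sw x (fun y z => P (smul (F y) (G z))).
Proof.
by case=> h e; rewrite e big_flatten big_map; apply: eq_bigr => q _; rewrite -e.
Qed.

Lemma rep_mulF F G u v p q : rep F u p -> rep G v q ->
  rep (mulF F G) (pconv (mul_bmap A) (pconv ra q u) (pconv la p v))
    (pconv (mul_bmap H) p q).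
Proof.
move=> hF hG U f hf x.
rewrite (ladm_mulF F G x (ladm_sum hf)); have [f1 f2] := hf.
pose g a b c d e h := f (ra (q h) (u a) * la (p b) (v d), p c * q e).
transitivity (sw x (fun y z => sw y (fun a y' => sw y' (fun b c =>
    sw z (fun d z' => sw z' (fun e h => g a b c d e h)))))).
  apply: eq_sw => y z; rewrite sum_smul.
  rewrite hF; last by apply: adm_sum => t; exact: adm_mulEl.
  apply: eq_sw => a y'; rewrite hG; last exact: adm_mulEr.
  rewrite sw_exch; apply: eq_sw => d z'.
  rewrite /mulE /= (@pt_cop _ _ _ p _ (fun b c => sw (q z' : co H)
    (fun e h => f (ra h (u a) * la b (v d), c * e)))).
    apply: eq_sw => b c; rewrite (@pt_cop _ _ _ q _ (fun e h =>
      f (ra h (u a) * la (p b) (v d), p c * e))) //.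
    apply: bilin_intro => e; first exact: (h_adm_lin (K := H) (f2 _) (bilin_linr _ bH)).
    apply: (h_adm_lin (K := H) (f1 _)).
    exact: (h_adm_lin (K := H) (bilin_linl _ bA) (bilin_linl _ br)).
  apply: bilin_intro => d'.
    apply: (@adm_sw_par _ (co H) (co H) U (q z') (fun b e h => f (ra h (u a) * la b (v d), d' * e))) => e h.
    apply: (adm_lin (f1 _)).
    exact: (h_adm_lin (K := H) (bilin_linr _ bA) (bilin_linl _ bl)).
  apply: (@adm_sw_par _ (co H) (co H) U (q z') (fun c e h => f (ra h (u a) * la d' (v d), c * e))) => e h.
  by apply: (adm_lin (f2 _)); exact: (bilin_linl _ bH).
transitivity (sw x (fun y z => sw y (fun s t => sw s (fun h a => sw t (fun b d =>
    sw z (fun c e => g a b c d e h)))))).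
  (* Read from its end, the word carries [h] from the first place to the last and then exchanges [d]
     and [c]. *)
  apply: (@swt_perm _ X U (Nd (Nd Lf (Nd Lf Lf)) (Nd Lf (Nd Lf Lf)))
    (Nd (Nd (Nd Lf Lf) (Nd Lf Lf)) (Nd Lf Lf)) [:: 2; 4; 3; 2; 1; 0]%N x
    (fun l => if l is [:: a; b; c; d; e; h] then g a b c d e h else 0)) => //=.
  do !split=> * //; rewrite /g.
  - by apply: (adm_lin (f1 _)); admp.
  - by apply: (adm_lin (f1 _)); admp.
  - by apply: (adm_lin (f2 _)); admp.
  - by apply: (adm_lin (f1 _)); admp.
  - by apply: (adm_lin (f2 _)); admp.
  - by apply: (adm_lin (f1 _)); admp.
apply: eq_sw => y z; rewrite /= /conv /= /conv.
rewrite [RHS](lin_sw _ _ (f1 _)); apply: eq_sw => s t.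
rewrite (lin_sw _ _ (bilin_linl _ bA)) (lin_sw _ _ (f1 _)); apply: eq_sw => h a.
rewrite (lin_sw _ _ (bilin_linr _ bA)) (lin_sw _ _ (f1 _)); apply: eq_sw => b d.
by rewrite (lin_sw _ _ (f2 _)).
Qed.

Lemma rep_sS F u p : rep F u p ->
  rep (fun x => sS (F x))
    (pconv la (pcompose (S_pt H) p) (pconv ra (pcompose (S_pt H) p) (pcompose (S_pt A) u)))
    (pcompose (S_pt H) p).
Proof.
move=> hF U f hf x; rewrite sum_sS hF; last exact: adm_SE.
have [f1 f2] := hf; have lS := @lin_S k.
pose g y c d b := f (la (hS (p b)) (ra (hS (p d)) (hS (u y))), hS (p c)).
transitivity (sw x (fun y z => sw z (fun a b => sw a (fun c d => g y c d b)))).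
  apply: eq_sw => y z; rewrite /SE /=.
  rewrite (@pt_cop _ _ _ p _ (fun a b => sw (a : co H) (fun c d =>
     f (la (hS b) (ra (hS d) (hS (u y))), hS c)))).
    apply: eq_sw => a b; rewrite (@pt_cop _ _ _ p _ (fun c d =>
     f (la (hS (p b)) (ra (hS d) (hS (u y))), hS c))) //.
    apply: bilin_intro => e; first exact: (h_adm_lin (K := H) (f2 _) (lS H)).
    apply: (h_adm_lin (K := H) (f1 _)); apply: (h_adm_lin (K := H) (bilin_linr _ bl)).
    exact: (h_adm_lin (K := H) (bilin_linl _ br) (lS H)).
  apply: bilin_intro => a.
    apply: lin_swh; apply: bilin_intro => e; first exact: (h_adm_lin (K := H) (f2 _) (lS H)).
    apply: (h_adm_lin (K := H) (f1 _)); apply: (h_adm_lin (K := H) (bilin_linr _ bl)).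
    exact: (h_adm_lin (K := H) (bilin_linl _ br) (lS H)).
  apply: (@adm_sw_par _ (co H) (co H) U a (fun b c d => f (la (hS b) (ra (hS d) (hS (u y))), hS c))) => d e.
  apply: (adm_lin (f1 _)).
  exact: (h_adm_lin (K := H) (bilin_linl _ bl) (lS H)).
transitivity (sw x (fun t c => sw t (fun b t' => sw t' (fun d y => g y c d b)))).
  apply: (@swt_perm _ X U (Nd Lf (Nd (Nd Lf Lf) Lf))
    (Nd (Nd Lf (Nd Lf Lf)) Lf) [:: 1; 0; 2; 1; 0]%N x
    (fun l => if l is [:: a; b; c; d] then g a b c d else 0)) => //=.
  have aS (q : pt X H) : adm (fun x => hS (q x)) := adm_lin (lS H) (pt_adm q).
  do !split=> * //; rewrite /g.
  - apply: (adm_lin (f1 _)); apply: adm_br; first exact: bmap_bilin.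
    by apply: adm_br; [exact: bmap_bilin | exact: adm_lin (lS A) (pt_adm u)].
  - exact: adm_lin (f2 _) (aS p).
  - apply: (adm_lin (f1 _)); apply: adm_br; first exact: bmap_bilin.
    by apply: adm_bl; [exact: bmap_bilin | exact: aS].
  - by apply: (adm_lin (f1 _)); apply: adm_bl; [exact: bmap_bilin | exact: aS].
apply: eq_sw => t c; rewrite /= /conv /= /conv; rewrite [RHS](lin_sw _ _ (f1 _)); apply: eq_sw => b t'.
by rewrite (lin_sw _ _ (bilin_linr _ bl)) (lin_sw _ _ (f1 _)).
Qed.

(** Linearity of [R] suffices for the list operation; the coalgebra structure in [Rp] is what makes
    [R] after [u] a point again. *)
Lemma rep_sRB (Rp : pt (co A) A) F u p : (forall a, Rp a = R a) -> rep F u p ->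
  rep (fun x => sRB (F x))
    (pconv ra (pcompose B p) (pconv la (pcompose B p) (pcompose Rp u))) (pcompose B p).
Proof.
move=> eR hF U f hf x; rewrite sum_sRB hF; last exact: adm_RE.
have [f1 f2] := hf; have lB := lin_B.
pose g y c d b := f (ra (B (p d)) (la (B (p c)) (R (u y))), B (p b)).
transitivity (sw x (fun y z => sw z (fun a b => sw a (fun c d => g y c d b)))).
  apply: eq_sw => y z; rewrite /RE /=.
  rewrite (@pt_cop _ _ _ p _ (fun a b => sw (a : co H) (fun c d =>
     f (ra (B d) (la (B c) (R (u y))), B b)))).
    apply: eq_sw => a b; rewrite (@pt_cop _ _ _ p _ (fun c d =>
     f (ra (B d) (la (B c) (R (u y))), B (p b)))) //.
    apply: bilin_intro => e.
      apply: (h_adm_lin (K := H) (f1 _)); apply: (h_adm_lin (K := H) (bilin_linr _ br)).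
      exact: (h_adm_lin (K := H) (bilin_linl _ bl) lB).
    apply: (h_adm_lin (K := H) (f1 _)).
    exact: (h_adm_lin (K := H) (bilin_linl _ br) lB).
  apply: bilin_intro => a.
    apply: lin_swh; apply: bilin_intro => e.
      apply: (h_adm_lin (K := H) (f1 _)); apply: (h_adm_lin (K := H) (bilin_linr _ br)).
      exact: (h_adm_lin (K := H) (bilin_linl _ bl) lB).
    apply: (h_adm_lin (K := H) (f1 _)).
    exact: (h_adm_lin (K := H) (bilin_linl _ br) lB).
  apply: (@adm_sw_par _ (co H) (co H) U a (fun b c d => f (ra (B d) (la (B c) (R (u y))), B b))) => d e.
  exact: (h_adm_lin (K := H) (f2 _) lB).
transitivity (sw x (fun t b => sw t (fun d t' => sw t' (fun c y => g y c d b)))).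
  apply: (@swt_perm _ X U (Nd Lf (Nd (Nd Lf Lf) Lf))
    (Nd (Nd Lf (Nd Lf Lf)) Lf) [:: 0; 1; 0]%N x
    (fun l => if l is [:: a; b; c; d] then g a b c d else 0)) => //=.
  have aB (q : pt X H) : adm (fun x => B (q x)) := adm_lin lB (pt_adm q).
  do !split=> * //; rewrite /g.
  - apply: (adm_lin (f1 _)); apply: adm_br; first exact: bmap_bilin.
    by apply: adm_br; [exact: bmap_bilin | exact: adm_lin linR (pt_adm u)].
  - apply: (adm_lin (f1 _)); apply: adm_br; first exact: bmap_bilin.
    by apply: adm_bl; [exact: bmap_bilin | exact: aB].
  - by apply: (adm_lin (f1 _)); apply: adm_bl; [exact: bmap_bilin | exact: aB].
  - exact: adm_lin (f2 _) (aB p).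
apply: eq_sw => t c; rewrite /= /conv /= /conv; rewrite [RHS](lin_sw _ _ (f1 _)); apply: eq_sw => b t'.
rewrite (lin_sw _ _ (bilin_linr _ br)) (lin_sw _ _ (f1 _)); apply: eq_sw => d y.
by rewrite /g /= eR.
Qed.

End Rep.

(** * The Rota-Baxter identity of the smash product under linear functionals *)

Local Notation scop := (smash_cop (@hcop _ A) (@hcop _ H)).
Local Notation SW := (smash_swalg (@hcop _ A) (@heps _ A) (@hS _ A)
  (@hcop _ H) (@heps _ H) (@hS _ H) la ract).

Lemma ladm_bigsum U (I : Type) (r : seq I) (P : I -> seq (A * H) -> U) :
  (forall i, ladm (P i)) -> ladm (fun l => \sum_(i <- r) P i l).
Proof.
move=> h; apply: (@ladm_intro _ _ (fun s => \sum_(i <- r) P i [:: s])).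
  by apply: adm_sum => i; case: (h i).
by move=> l; rewrite exchange_big; apply: eq_bigr => i _; case: (h i) => _ ->.
Qed.

Lemma ladm_eq U (P Q : seq (A * H) -> U) : ladm P -> (forall l, Q l = P l) -> ladm Q.
Proof. by move=> hP /functional_extensionality ->. Qed.

Lemma ladm_cat U (P : seq (A * H) -> U) l l' : ladm P -> P (l ++ l') = P l + P l'.
Proof. by case=> _ h; rewrite h big_cat -!h. Qed.

Lemma ladm_nil U (P : seq (A * H) -> U) : ladm P -> P [::] = 0.
Proof. by case=> _ h; rewrite h big_nil. Qed.

Lemma ladm_tscale U (P : seq (A * H) -> U) (c : k) l : ladm P ->
  P (tscale (V := A) (W := H) c l) = c *: P l.
Proof.
case=> -[h1 h2] h; rewrite h big_map [in RHS]h scaler_sumr; apply: eq_bigr => -[a b] _.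
by rewrite /= (linZ c a (h1 b)).
Qed.

Lemma ladm_sw_sum U (P : seq (A * H) -> U) (s : seq (sw_car SW)) :
  ladm P -> P (sw_sum (X := SW) s) = \sum_(l <- s) P l.
Proof.
move=> hP; elim: s => [|l s IH]; first by rewrite big_nil; exact: ladm_nil.
by rewrite big_cons -IH; exact: ladm_cat.
Qed.

Lemma sum_scop U (P : seq (A * H) -> seq (A * H) -> U) l :
  \sum_(p <- scop l) P p.1 p.2 = \sum_(s <- l) sw (s : AH) (fun a b => P [:: a] [:: b]).
Proof.
rewrite big_flatten big_map; apply: eq_bigr => s _.
by rewrite big_allpairs_dep sw_prod.
Qed.

(** The three Sweedler factors of the first variable occupy separate slots, so that functionals
    become linear in each of them. *)
Definition RBarg (l1 l2 l' l3 : seq (A * H)) : seq (A * H) :=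
  smul (smul (smul l1 (sRB l2)) l') (sS (sRB l3)).

Definition RBrhs U (P : seq (A * H) -> U) (l l' : seq (A * H)) : U :=
  \sum_(s <- l) sw (s : AH) (fun a b => sw a (fun c d => P (RBarg [:: c] [:: d] l' [:: b]))).

Lemma RBrhsE U (P : seq (A * H) -> U) l l' : ladm P ->
  P (sw_sum (X := SW) [seq RBarg t.1.1 t.1.2 l' t.2 | t <- cop2 scop l]) = RBrhs P l l'.
Proof.
move=> hP; rewrite ladm_sw_sum // big_map big_cop2.
rewrite (@sum_scop _ (fun l1 l2 => \sum_(q <- scop l1) P (RBarg q.1 q.2 l' l2))).
apply: eq_bigr => s _; apply: eq_sw => a b.
by rewrite (@sum_scop _ (fun l1 l2 => P (RBarg l1 l2 l' [:: b]))) big_seq1.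
Qed.

Section RBargLadm.
Variables (U : lmodType k) (P : seq (A * H) -> U).
Hypothesis hP : ladm P.

Lemma ladm_RBarg1 l2 l' l3 : ladm (fun l1 => P (RBarg l1 l2 l' l3)).
Proof.
apply: (@ladm_smull _ (fun l => P (smul (smul l l') (sS (sRB l3))))).
apply: (@ladm_smull _ (fun l => P (smul l (sS (sRB l3))))).
exact: (@ladm_smull _ P).
Qed.

Lemma ladm_RBarg2 l1 l' l3 : ladm (fun l2 => P (RBarg l1 l2 l' l3)).
Proof.
apply: (@ladm_sRB _ (fun l => P (smul (smul (smul l1 l) l') (sS (sRB l3))))).
apply: (@ladm_smulr _ (fun l => P (smul (smul l l') (sS (sRB l3))))).
apply: (@ladm_smull _ (fun l => P (smul l (sS (sRB l3))))).
exact: (@ladm_smull _ P).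
Qed.

Lemma ladm_RBarg3 l1 l2 l3 : ladm (fun l' => P (RBarg l1 l2 l' l3)).
Proof.
apply: (@ladm_smulr _ (fun l => P (smul l (sS (sRB l3))))).
exact: (@ladm_smull _ P).
Qed.

Lemma ladm_RBarg4 l1 l2 l' : ladm (fun l3 => P (RBarg l1 l2 l' l3)).
Proof.
apply: (@ladm_sRB _ (fun l => P (smul (smul (smul l1 (sRB l2)) l') (sS l)))).
apply: (@ladm_sS _ (fun l => P (smul (smul (smul l1 (sRB l2)) l') l))).
exact: (@ladm_smulr _ P).
Qed.

Lemma adm_RBrhs_inner l' b :
  @adm k AH U (fun a => sw a (fun c d => P (RBarg [:: c] [:: d] l' [:: b]))).
Proof.
apply: adm_sw => [d | c]; first by case: (ladm_RBarg1 [:: d] l' [:: b]).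
by case: (ladm_RBarg2 [:: c] l' [:: b]).
Qed.

Lemma adm_RBrhs_outer l' (a : AH) :
  @adm k AH U (fun b => sw a (fun c d => P (RBarg [:: c] [:: d] l' [:: b]))).
Proof. by apply: adm_sw_par => c d; case: (ladm_RBarg4 [:: c] [:: d] l'). Qed.

Lemma ladm_RBrhsl l' : ladm (fun l => RBrhs P l l').
Proof.
by apply: ladm_sum; apply: adm_sw => s; [exact: adm_RBrhs_inner | exact: adm_RBrhs_outer].
Qed.

Lemma ladm_RBrhsr l : ladm (RBrhs P l).
Proof.
by do 3![apply: ladm_bigsum => ?]; exact: ladm_RBarg3.
Qed.

(** [rep_cop] trades coproducts of the smash product for coproducts of [X]; cocommutativity of [X]
    then moves the factor of [G] from the last place to the third, where the product has it. *)
Lemma RBrhs_mulF (X : coalg k) (F G : X -> seq (A * H)) u v p q x :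
  rep F u p -> rep G v q ->
  sw x (fun y z => RBrhs P (F y) (G z)) =
  P (mulF (mulF (mulF F (fun x => sRB (F x))) G) (fun x => sS (sRB (F x))) x).
Proof.
move=> hF hG.
rewrite (ladm_mulF _ _ _ hP).
transitivity (sw x (fun y z => sw y (fun a b => sw a (fun c d => P (RBarg (F c) (F d) (G z) (F b)))))).
  apply: eq_sw => y z.
  rewrite /RBrhs (rep_cop y hF (adm_RBrhs_inner _) (adm_RBrhs_outer _)).
  apply: eq_sw => a b; rewrite exchange_big.
  transitivity (\sum_(t <- F b) sw a (fun c d => P (RBarg (F c) (F d) (G z) [:: t]))); last first.
    rewrite exchange_big; apply: eq_bigr => r _; symmetry.
    by case: (ladm_RBarg4 (F r.1) (F r.2) (G z)) => _; apply.
  apply: eq_bigr => t _; rewrite (rep_cop a hF).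
  - apply: eq_sw => c d; case: (ladm_RBarg1 (F d) (G z) [:: t]) => _ ->.
    apply: eq_bigr => s _; symmetry.
    by case: (ladm_RBarg2 [:: s] (G z) [:: t]) => _; apply.
  - by move=> d; case: (ladm_RBarg1 [:: d] (G z) [:: t]).
  - by move=> c; case: (ladm_RBarg2 [:: c] (G z) [:: t]).
rewrite (@sw_assocC _ _ _ (fun a b z => sw a (fun c d => P (RBarg (F c) (F d) (G z) (F b))))).
- apply: eq_sw => y z.
  have h1 : ladm (fun l => P (smul l (sS (sRB (F z))))) by exact: (@ladm_smull _ P).
  rewrite (ladm_mulF _ _ _ h1); apply: eq_sw => a b.
  have h2 : ladm (fun l => P (smul (smul l (G b)) (sS (sRB (F z))))).
    exact: (@ladm_smull _ (fun l => P (smul l (sS (sRB (F z)))))).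
  by rewrite (ladm_mulF _ _ _ h2).
- move=> b z; apply: adm_sw => w.
    exact: (rep_adm hF (ladm_RBarg1 (F w) (G z) (F b))).
  exact: (rep_adm hF (ladm_RBarg2 (F w) (G z) (F b))).
- move=> a z; apply: adm_sw_par => c d.
  exact: (rep_adm hF (ladm_RBarg4 (F c) (F d) (G z))).
- move=> a b; apply: adm_sw_par => c d.
  exact: (rep_adm hG (ladm_RBarg3 (F c) (F d) (F b))).
Qed.

End RBargLadm.

(** The bilinear maps in [tens_eq] are exactly the restrictions of [ladm] functionals to single pure
    tensors. *)
Lemma smash_eqvP (l l' : seq (A * H)) : smash_eqv l l' <->
  (forall U (P : seq (A * H) -> U), ladm P -> P l = P l').
Proof.
split=> [h U P hP | h U f hf].
  have [[h1 h2] e] := hP; rewrite e [RHS]e.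
  have e2 (m : seq (A * H)) : \sum_(s <- m) P [:: s] = \sum_(s <- m) P [:: (s.1, s.2)].
    by apply: eq_bigr => -[].
  rewrite !e2; apply: (h U (fun a b => P [:: (a, b)])).
  by apply: bilin_intro => z; [exact: h1 | exact: h2].
apply: (h U (fun l => \sum_(s <- l) f s.1 s.2)); apply: ladm_sum.
by split=> z; [exact: bilin_linl hf | exact: bilin_linr hf].
Qed.

(** A pure tensor with a linear combination as one entry is equivalent to a concatenation of lists;
    linearity on lists therefore yields bilinearity on pure tensors. *)
Lemma ladm_of_eqv U (P : seq (A * H) -> U) :
  (forall l l', smash_eqv l l' -> P l = P l') ->
  (forall c l l', P (tscale (V := A) (W := H) c l ++ l') = c *: P l + P l') -> ladm P.
Proof.
move=> h1 h2; split.
  split=> z c x y; rewrite -(h2 c [:: _] [:: _]); apply: h1; apply/smash_eqvP => V Q hQ;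
    rewrite [RHS](ladm_cat [:: _] [:: _] hQ); have [[q1 q2] _] := hQ.
    by rewrite [Q [:: (_ *: x, z)]](linZ c x (q1 z)); exact: q1.
  by rewrite [Q [:: (_ *: z, x)]](linZ c z (q1 x)); exact: q2.
have e l l' : P (l ++ l') = P l + P l'.
  rewrite -[P l]scale1r -h2; congr (P (_ ++ _)).
  by elim: l => //= -[a b] l <-; rewrite scale1r.
elim=> [|s l IH]; last by rewrite -cat1s e big_cat big_seq1 -IH.
by rewrite big_nil; have := e [::] [::]; rewrite -[LHS]addr0 => /addrI.
Qed.

Lemma sw_bilin_ladm U (f : seq (A * H) -> seq (A * H) -> U) : sw_bilin (X := SW) f ->
  (forall l', ladm (fun l => f l l')) /\ (forall l, ladm (f l)).
Proof.
case=> h1 h2 h3 h4; split=> m; apply: ladm_of_eqv.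
- by move=> l l' e; exact: h1.
- by move=> c l l'; exact: h3.
- by move=> l l' e; exact: h2.
- by move=> c l l'; exact: h4.
Qed.

Lemma sum_sRB_pure U (f : AH -> U) l :
  \sum_(r <- sRB l) f r = \sum_(s <- l) \sum_(r <- sRB [:: s]) f r.
Proof. by rewrite sum_sRB; apply: eq_bigr => s _; rewrite sum_sRB big_seq1. Qed.

Lemma sRB_eqv l l' : smash_eqv l l' -> smash_eqv (sRB l) (sRB l').
Proof.
move/smash_eqvP => h; apply/smash_eqvP => U P hP.
exact: (h U _ (ladm_sRB hP)).
Qed.

Lemma sRB_lin c l l' :
  smash_eqv (sRB (tscale (V := A) (W := H) c l ++ l'))
    (tscale (V := A) (W := H) c (sRB l) ++ sRB l').
Proof.
apply/smash_eqvP => U P hP.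
rewrite (ladm_cat (P := fun l => P (sRB l)) _ _ (ladm_sRB hP)).
rewrite (ladm_tscale (P := fun l => P (sRB l)) c l (ladm_sRB hP)).
by rewrite ladm_cat // ladm_tscale.
Qed.

(** * Restriction of [Bbar] to [A # 1] *)

Section UnitPart.
Hypothesis B1 : B 1 = 1.
Hypothesis la1 : forall a, la 1 a = a.
Hypothesis ra1 : forall a, ra 1 a = a.

Lemma sRB_unit U (P : seq (A * H) -> U) a : ladm P ->
  P (sRB [:: (a, 1)]) = P [:: (R a, 1)].
Proof.
move=> hP; have [hf e] := hP; rewrite e sum_sRB big_seq1 /RE /=.
have [f1 f2] := hf; have lB := lin_B.
have h1 z : bilin (fun u v => P [:: (ra (B v) (la (B u) (R a)), B z)]).
  apply: bilin_intro => r; apply: (h_adm_lin (K := H) (f1 _)).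
    apply: (h_adm_lin (K := H) (bilin_linr _ br)).
    exact: (h_adm_lin (K := H) (bilin_linl _ bl) lB).
  exact: (h_adm_lin (K := H) (bilin_linl _ br) lB).
rewrite sw_1; last first.
  apply: bilin_intro => r; first exact: (lin_swh (h1 _)).
  apply: (@adm_sw_par _ (co H) (co H) U r (fun z u v => P [:: (ra (B v) (la (B u) (R a)), B z)])) => u v.
  exact: (h_adm_lin (K := H) (f2 _) lB).
by rewrite sw_1 // B1 la1 ra1.
Qed.

(** The coproduct law of [Bbar] at [a # 1] is tested against [F], that is [f] after discarding both
    [H]-components by the counit. *)
Lemma coalg_of_sRB :
  (forall l, sw_teq2 (X := SW) (scop (sRB l)) [seq (sRB p.1, sRB p.2) | p <- scop l]) ->
  forall U (f : A -> A -> U), bilin f -> forall a,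
    sw (R a : co A) f = sw (a : co A) (fun y z => f (R y) (R z)).
Proof.
move=> h U f hf a.
pose P (b : A) (l : seq (A * H)) : U := \sum_(t <- l) (heps t.2 *: f b t.1).
pose F (l l' : seq (A * H)) : U := \sum_(s <- l) heps s.2 *: P s.1 l'.
have hPl m : ladm (P m).
  apply: ladm_sum; split=> z /=; last exact: lin_hepsZ.
  apply: (@adm_scale _ (co A) U); exact: (bilin_linr _ hf).
have hFr l : ladm (F l).
  apply: ladm_bigsum => s; apply: (@ladm_eq _ (fun l' => \sum_(t <- l') heps s.2 *: (heps t.2 *: f s.1 t.1))).
    apply: ladm_sum; apply: adm_scale; split=> z /=; last exact: lin_hepsZ.
    apply: (@adm_scale _ (co A) U); exact: (bilin_linr _ hf).
  by move=> l'; rewrite scaler_sumr.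
have hFl l' : ladm (fun l => F l l').
  apply: ladm_sum; split=> z /=; last exact: lin_hepsZ.
  apply: (@adm_scale _ (co A) U).
  apply: (@adm_sum _ (co A) U _ l' (fun t x => heps t.2 *: f x t.1)) => t.
  apply: (@adm_scale _ (co A) U); exact: (bilin_linl _ hf).
have F1 b c d e : F [:: (b, c)] [:: (d, e)] = heps c *: (heps e *: f b d).
  by rewrite /F /P !big_seq1.
have hF : sw_bilin (X := SW) F.
  split.
  - by move=> l l' m e; apply: (proj1 (smash_eqvP l l') e _ (fun l => F l m)).
  - by move=> m l l' e; apply: (proj1 (smash_eqvP l l') e _ (F m)).
  - by move=> c l l' m; rewrite (ladm_cat (P := fun l => F l m)) // (ladm_tscale (P := fun l => F l m)).
  - by move=> c m l l'; rewrite (ladm_cat (P := F m)) // (ladm_tscale (P := F m)).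
have := h [:: (a, 1)] U F hF; rewrite big_map !sum_scop (sum_scop (fun l l' => F (sRB l) (sRB l'))) !big_seq1.
have [aF1 aF2] : (forall t, @adm k AH U (fun s => F [:: s] [:: t])) /\ (forall s, @adm k AH U (fun t => F [:: s] [:: t])).
  by split=> s; [case: (hFl [:: s]) | case: (hFr [:: s])].
have hS : ladm (fun l => \sum_(s <- l) sw (s : AH) (fun b c => F [:: b] [:: c])).
  by apply: ladm_sum; apply: adm_sw.
rewrite (sRB_unit a hS) big_seq1 !sw_prod /= => e.
transitivity (sw (R a : co A) (fun b c => sw (1 : co H) (fun d e => F [:: (b, d)] [:: (c, e)]))).
  apply: eq_sw => b c; rewrite sw_1; first by rewrite F1 heps1 !scale1r.
  by apply: bilin_intro => z; [case: (aF1 (c, z)) => _; apply | case: (aF2 (b, z)) => _; apply].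
rewrite e; apply: eq_sw => b c.
have g1 l : ladm (fun l' => F (sRB l') (sRB l)) := ladm_sRB (hFl (sRB l)).
have g2 l : ladm (fun l' => F (sRB l) (sRB l')) := ladm_sRB (hFr (sRB l)).
rewrite sw_1; last first.
  apply: bilin_intro => z; first by case: (g1 [:: (c, z)]) => -[_ g] _; exact: (g b).
  by case: (g2 [:: (b, z)]) => -[_ g] _; exact: (g c).
rewrite (sRB_unit (P := fun l => F l _) b (hFl _)) (sRB_unit (P := F _) c (hFr _)).
by rewrite F1 heps1 !scale1r.
Qed.

Lemma eps_of_sRB :
  (forall l, smash_eps (@heps _ A) (@heps _ H) (sRB l) = smash_eps (@heps _ A) (@heps _ H) l) ->
  forall a, heps (R a) = heps a.
Proof.
move=> h a; have := h [:: (a, 1)].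
have hS : @ladm k^o (smash_eps (@heps _ A) (@heps _ H)) := ladm_sum (adm_ceps AH).
by rewrite (sRB_unit a hS) /smash_eps !big_seq1 /= heps1 !mulr1.
Qed.

End UnitPart.

(** * The two conditions on elements and on points *)

Section PointConditions.
Variable Rp : pt (co A) A.
Hypothesis eR : forall a, Rp a = R a.
Hypothesis RB_B : forall x y : H,
  B x * B y = B (sw (x : co H) (fun t c => sw (t : co H) (fun a b => a * B b * y * hS (B c)))).

Hypothesis la1 : forall a, la 1 a = a.
Hypothesis laM : forall h g a, la (h * g) a = la h (la g a).
Hypothesis ra1 : forall a, ra 1 a = a.
Hypothesis raM : forall h g a, ra (h * g) a = ra g (ra h a).
Hypothesis la_ra : forall h g a, ra g (la h a) = la h (ra g a).
Hypothesis laD : forall h a b,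
  la h (a * b) = sw (h : co H) (fun h1 h2 => la h1 a * la h2 b).
Hypothesis raD : forall h a b,
  ra h (a * b) = sw (h : co H) (fun h1 h2 => ra h1 a * ra h2 b).

Lemma lin_Rp : lin Rp. Proof. exact: (pt_adm Rp). Qed.

Definition cond1_arg (a b : A) (h : H) : A :=
  sw (a : co A) (fun t c => sw (t : co A) (fun a1 a2 => sw (h : co H) (fun h1 h2 =>
    ra h1 (a1 * Rp a2) * b * la h2 (hS (Rp c))))).

Lemma cond1_bilin1 (a b c : A) : bilin (fun h1 h2 => ra h1 a * b * la h2 c).
Proof.
apply: bilin_intro => r; last exact: (h_adm_lin (K := H) (bilin_linr _ bA) (bilin_linl _ bl)).
apply: (h_adm_lin (K := H) (bilin_linl _ bA)).
exact: (h_adm_lin (K := H) (bilin_linl _ bA) (bilin_linl _ br)).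
Qed.

Lemma cond1_bilin2 (b c : A) (h : H) :
  bilin (fun a1 a2 => sw (h : co H) (fun h1 h2 =>
    ra h1 (a1 * Rp a2) * b * la h2 (hS (Rp c)))).
Proof.
apply: bilin_intro => r.
  apply: (@adm_sw_par _ (co A) (co H) A h (fun a1 h1 h2 =>
    ra h1 (a1 * Rp r) * b * la h2 (hS (Rp c)))) => d e.
  do 2!apply: (h_adm_lin (K := A) (bilin_linl _ bA)).
  exact: (h_adm_lin (K := A) (bilin_linr _ br) (bilin_linl _ bA)).
apply: (@adm_sw_par _ (co A) (co H) A h (fun a2 h1 h2 =>
    ra h1 (r * Rp a2) * b * la h2 (hS (Rp c)))) => d e.
do 2!apply: (h_adm_lin (K := A) (bilin_linl _ bA)).
apply: (h_adm_lin (K := A) (bilin_linr _ br)).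
exact: (h_adm_lin (K := A) (bilin_linr _ bA) lin_Rp).
Qed.

Lemma cond1_bilin3 (b : A) (h : H) :
  bilin (fun t c => sw (t : co A) (fun a1 a2 => sw (h : co H) (fun h1 h2 =>
    ra h1 (a1 * Rp a2) * b * la h2 (hS (Rp c))))).
Proof.
apply: bilin_intro => r; first exact: (lin_swh (cond1_bilin2 _ _ _)).
apply: (@adm_sw_par _ (co A) (co A) A r (fun c a1 a2 => sw (h : co H) (fun h1 h2 =>
    ra h1 (a1 * Rp a2) * b * la h2 (hS (Rp c))))) => d e.
apply: (@adm_sw_par _ (co A) (co H) A h (fun c h1 h2 =>
    ra h1 (d * Rp e) * b * la h2 (hS (Rp c)))) => h1 h2.
apply: (h_adm_lin (K := A) (bilin_linr _ bA)); apply: (h_adm_lin (K := A) (bilin_linr _ bl)).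
exact: (h_adm_lin (K := A) (@lin_S _ _) lin_Rp).
Qed.

Lemma cond1_lina b h : lin (fun a => cond1_arg a b h).
Proof. exact: (lin_swh (cond1_bilin3 b h)). Qed.

Lemma cond1_linb a h : lin (fun b => cond1_arg a b h).
Proof.
apply: (@adm_sw_par _ (co A) (co A) A a (fun b t c => sw (t : co A) (fun a1 a2 =>
  sw (h : co H) (fun h1 h2 => ra h1 (a1 * Rp a2) * b * la h2 (hS (Rp c)))))) => t c.
apply: (@adm_sw_par _ (co A) (co A) A t (fun b a1 a2 =>
  sw (h : co H) (fun h1 h2 => ra h1 (a1 * Rp a2) * b * la h2 (hS (Rp c))))) => a1 a2.
apply: (@adm_sw_par _ (co A) (co H) A h (fun b h1 h2 =>
  ra h1 (a1 * Rp a2) * b * la h2 (hS (Rp c)))) => h1 h2.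
exact: (h_adm_lin (K := A) (bilin_linl _ bA) (bilin_linr _ bA)).
Qed.

Lemma cond1_linh a b : lin (cond1_arg a b).
Proof.
apply: (@adm_sw_par _ (co H) (co A) A a (fun h t c => sw (t : co A) (fun a1 a2 =>
  sw (h : co H) (fun h1 h2 => ra h1 (a1 * Rp a2) * b * la h2 (hS (Rp c)))))) => t c.
apply: (@adm_sw_par _ (co H) (co A) A t (fun h a1 a2 =>
  sw (h : co H) (fun h1 h2 => ra h1 (a1 * Rp a2) * b * la h2 (hS (Rp c))))) => a1 a2.
exact: (lin_swh (cond1_bilin1 _ _ _)).
Qed.

Definition cond2_arg (b : A) (h : H) : A :=
  sw (h : co H) (fun t c => sw (t : co H) (fun h1 h2 =>
    ra (hS (B c)) (la (h1 * B h2) b))).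

Lemma cond2_bilin1 (b : A) (c : H) :
  bilin (fun h1 h2 => ra (hS (B c)) (la (h1 * B h2) b)).
Proof.
apply: bilin_intro => r; apply: (h_adm_lin (K := H) (bilin_linr _ br));
  apply: (h_adm_lin (K := H) (bilin_linl _ bl)).
  exact: (bilin_linl _ bH).
exact: (h_adm_lin (K := H) (bilin_linr _ bH) lin_B).
Qed.

Lemma cond2_bilin2 (b : A) :
  bilin (fun t c => sw (t : co H) (fun h1 h2 => ra (hS (B c)) (la (h1 * B h2) b))).
Proof.
apply: bilin_intro => r; first exact: (lin_swh (cond2_bilin1 _ _)).
apply: (@adm_sw_par _ (co H) (co H) A r (fun c h1 h2 =>
    ra (hS (B c)) (la (h1 * B h2) b))) => d e.
exact: (h_adm_lin (K := H) (bilin_linl _ br) (h_adm_lin (K := H) (@lin_S _ _) lin_B)).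
Qed.

Lemma cond2_linh b : lin (cond2_arg b).
Proof. exact: (lin_swh (cond2_bilin2 b)). Qed.

Lemma cond2_linb h : lin (fun b => cond2_arg b h).
Proof.
apply: (@adm_sw_par _ (co A) (co H) A h (fun b t c => sw (t : co H) (fun h1 h2 =>
  ra (hS (B c)) (la (h1 * B h2) b)))) => t c.
apply: (@adm_sw_par _ (co A) (co H) A t (fun b h1 h2 =>
  ra (hS (B c)) (la (h1 * B h2) b))) => h1 h2.
exact: (h_adm_lin (K := A) (bilin_linr _ br) (bilin_linr _ bl)).
Qed.

Section AtX.
Variable X : coalg k.

Local Notation mulA := (pconv (X := X) (mul_bmap A)).
Local Notation mulH := (pconv (X := X) (mul_bmap H)).
Local Notation invA := (pcompose (X := X) (S_pt A)).
Local Notation invH := (pcompose (X := X) (S_pt H)).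
Local Notation L := (pconv (X := X) la).
Local Notation Q := (pconv (X := X) ra).
Local Notation Bp := (pcompose (X := X) B).
Local Notation RX := (pcompose (X := X) Rp).

(** For elements the Sweedler factors of [x] are split off first; in the convolution product the
    leaf of [q] precedes the third leaf of [p]. Cocommutativity of [X] exchanges these two. *)
Lemma RB_B_pt (p q : pt X H) :
  mulH (Bp p) (Bp q) = Bp (mulH (mulH (mulH p (Bp p)) q) (invH (Bp p))).
Proof.
apply: pt_eq => x.
pose g a b c d := B (p a * B (p b) * q d * hS (B (p c))).
have lB := lin_B; have lS := @lin_S _ H.
transitivity (sw x (fun y d => sw y (fun t c => sw t (fun a b => g a b c d)))).
  apply: eq_sw => y d; rewrite /= RB_B.
  have h1 e : bilin (fun a b => a * B b * q d * hS (B e)).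
    apply: bilin_intro => h; do 2!apply: (h_adm_lin (K := H) (bilin_linl _ bH)).
      exact: (bilin_linl _ bH).
    exact: (h_adm_lin (K := H) (bilin_linr _ bH) lB).
  rewrite (@pt_cop _ _ _ p _ (fun t c => sw (t : co H) (fun a b => a * B b * q d * hS (B c)))).
    rewrite (lin_sw _ _ lB); apply: eq_sw => t c.
    by rewrite (@pt_cop _ _ _ p _ (fun a b => a * B b * q d * hS (B (p c)))) // (lin_sw _ _ lB).
  apply: bilin_intro => e; first exact: (lin_swh (h1 e)).
  apply: (@adm_sw_par _ (co H) (co H) H e (fun c a b => a * B b * q d * hS (B c))) => a b.
  exact: (h_adm_lin (K := H) (bilin_linr _ bH) (h_adm_lin (K := H) lS lB)).
transitivity (sw x (fun y c => sw y (fun t d => sw t (fun a b => g a b c d)))).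
  have aB : adm (fun x => B (p x)) := adm_lin lB (pt_adm p).
  have aS : adm (fun x => hS (B (p x))) := adm_lin lS aB.
  apply: (@sw_assocC _ X H (fun t c d => sw t (fun a b => g a b c d))) => [c d | t d | t c].
  - by apply: adm_sw => e; apply: adm_lin lB _; do 2!(apply: adm_bl; first exact: bH); admp.
  - by apply: adm_sw_par => a b; apply: adm_lin lB _; admp.
  - by apply: adm_sw_par => a b; apply: adm_lin lB _; admp.
rewrite [RHS]pcompose_pconv; apply: eq_sw => y c; rewrite /= /conv.
rewrite (lin_sw _ _ (bilin_linl _ bH)) (lin_sw _ _ lB); apply: eq_sw => t d.
rewrite /= /conv (lin_sw _ _ (bilin_linl _ bH)) (lin_sw _ _ (bilin_linl _ bH)).
by rewrite (lin_sw _ _ lB).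
Qed.

(** Over points the condition is a Sweedler sum of its instances at elements, so the elementwise
    condition implies it for every [X]. *)
Lemma cond1_pt (u v : pt X A) (p : pt X H) x :
  RX (mulA (mulA (Q p (mulA u (RX u))) v) (L p (invA (RX u)))) x =
  sw x (fun y z => sw y (fun a h => Rp (cond1_arg (u a) (v z) (p h)))).
Proof.
have lR := lin_Rp; have lS := @lin_S _ A.
pose g a b c h l z := Rp (ra (p h) (u a * Rp (u b)) * v z * la (p l) (hS (Rp (u c)))).
transitivity (sw x (fun y z => sw y (fun a h => sw a (fun t c => sw t (fun a b =>
    sw h (fun h l => g a b c h l z)))))); last first.
  apply: eq_sw => y z; apply: eq_sw => a h; rewrite /cond1_arg.
  rewrite (@pt_cop _ _ _ u _ (fun t c => sw (t : co A) (fun a1 a2 => sw (p h : co H)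
    (fun h1 h2 => ra h1 (a1 * Rp a2) * v z * la h2 (hS (Rp c)))))).
    rewrite (lin_sw _ _ lR); apply: eq_sw => t c.
    rewrite (pt_cop u (cond1_bilin2 _ _ _)) (lin_sw _ _ lR); apply: eq_sw => a' b.
    by rewrite (pt_cop p (cond1_bilin1 _ _ _)) (lin_sw _ _ lR).
  exact: cond1_bilin3.
transitivity (sw x (fun y t => sw y (fun s z => sw s (fun h d => sw d (fun a b =>
    sw t (fun l c => g a b c h l z)))))); last first.
  symmetry.
  apply: (@swt_perm _ X A (Nd (Nd (Nd (Nd Lf Lf) Lf) (Nd Lf Lf)) Lf)
    (Nd (Nd (Nd Lf (Nd Lf Lf)) Lf) (Nd Lf Lf)) [:: 4; 2; 3; 4; 1; 0]%N x
    (fun l => if l is [:: a; b; c; h; l; z] then g a b c h l z else 0)) => //=.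
  have aR : adm (fun x => Rp (u x)) := adm_lin lR (pt_adm u).
  have aS : adm (fun x => hS (Rp (u x))) := adm_lin lS aR.
  by do !split=> * //; apply: (adm_lin lR); admp.
rewrite [LHS]pcompose_pconv; apply: eq_sw => y t; rewrite /= /conv.
rewrite (lin_sw _ _ (bilin_linl _ bA)) (lin_sw _ _ lR); apply: eq_sw => s z.
rewrite /= /conv (lin_sw _ _ (bilin_linl _ bA)) (lin_sw _ _ (bilin_linl _ bA)).
rewrite (lin_sw _ _ lR); apply: eq_sw => h d.
rewrite /= /conv (lin_sw _ _ (bilin_linr _ br)) (lin_sw _ _ (bilin_linl _ bA)).
rewrite (lin_sw _ _ (bilin_linl _ bA)) (lin_sw _ _ lR); apply: eq_sw => a b.
by rewrite (lin_sw _ _ (bilin_linr _ bA)) (lin_sw _ _ lR).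
Qed.

Lemma cond1_rhs_pt (u v : pt X A) (p : pt X H) x :
  mulA (L (invH (Bp p)) (RX u)) (RX v) x =
  sw x (fun y z => sw y (fun a h => la (hS (B (p h))) (Rp (u a)) * Rp (v z))).
Proof.
apply: eq_sw => y z; rewrite /= /conv (lin_sw _ _ (bilin_linl _ bA)).
have aR : adm (fun x => Rp (u x)) := adm_lin lin_Rp (pt_adm u).
have aS : adm (fun x => hS (B (p x))) := pt_adm (invH (Bp p)).
by rewrite sw_comm //= => *; admp.
Qed.

Lemma cond2_pt (v : pt X A) (p : pt X H) x :
  RX (Q (invH (Bp p)) (L (mulH p (Bp p)) v)) x =
  sw x (fun y z => Rp (cond2_arg (v z) (p y))).
Proof.
have lR := lin_Rp; have lS := @lin_S _ H; have lB := lin_B.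
pose g a b c z := Rp (ra (hS (B (p c))) (la (p a * B (p b)) (v z))).
transitivity (sw x (fun y z => sw y (fun t c => sw t (fun a b => g a b c z)))); last first.
  apply: eq_sw => y z; rewrite /cond2_arg.
  rewrite (@pt_cop _ _ _ p _ (fun t c => sw (t : co H) (fun h1 h2 =>
      ra (hS (B c)) (la (h1 * B h2) (v z))))).
    rewrite (lin_sw _ _ lR); apply: eq_sw => t c.
    by rewrite (pt_cop p (cond2_bilin1 _ _)) (lin_sw _ _ lR).
  exact: cond2_bilin2.
transitivity (sw x (fun c y => sw y (fun s z => sw s (fun a b => g a b c z)))); last first.
  symmetry.
  apply: (@swt_perm _ X A (Nd (Nd (Nd Lf Lf) Lf) Lf)
    (Nd Lf (Nd (Nd Lf Lf) Lf)) [:: 1; 0]%N x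
    (fun l => if l is [:: a; b; c; z] then g a b c z else 0)) => //=.
  have aB : adm (fun x => B (p x)) := adm_lin lB (pt_adm p).
  have aS : adm (fun x => hS (B (p x))) := adm_lin lS aB.
  by do !split=> * //; apply: (adm_lin lR); admp.
rewrite [LHS]pcompose_pconv; apply: eq_sw => c y; rewrite /= /conv.
rewrite (lin_sw _ _ (bilin_linr _ br)) (lin_sw _ _ lR); apply: eq_sw => s z.
rewrite /= /conv (lin_sw _ _ (bilin_linl _ bl)) (lin_sw _ _ (bilin_linr _ br)).
by rewrite (lin_sw _ _ lR).
Qed.

Lemma RB_cond_pt :
  RB_cond mulH invH mulA invA L Q Bp RX <->
  RB_cond1 invH mulA invA L Q Bp RX /\ RB_cond2 mulH invH L Q Bp RX.
Proof.
apply: (@group_RB _ _ mulH (pone H X) invH mulA (pone A X) invA).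
- exact: pmulA.
- exact: pmul_onel.
- exact: pmul_oner.
- exact: pmulV.
- exact: pmulVr.
- exact: pmulA.
- exact: pmul_onel.
- exact: pmul_oner.
- exact: pmulV.
- exact: pmulVr.
- by move=> a; apply: pconv_onel.
- by move=> h g a; apply: pconv_assoc => x y z; exact: laM.
- by move=> a; apply: pconv_onel.
- by move=> h g a; apply: pconv_antiassoc => x y z; exact: raM.
- by move=> h g a; apply: pconv_leftcomm => x y z; exact: la_ra.
- by move=> h a b; apply: pconv_distr.
- by move=> h a b; apply: pconv_distr.
- exact: RB_B_pt.
Qed.

Lemma smash_lhs_pt U (P : seq (A * H) -> U) F G u v p q x :
  ladm P -> rep F u p -> rep G v q ->
  sw x (fun y z => P (smul (sRB (F y)) (sRB (G z)))) =
  sw x (fun y z => P [:: (lhs_act mulA L Q Bp RX u v p q y, mulH (Bp p) (Bp q) z)]).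
Proof.
move=> hP hF hG; rewrite -(ladm_mulF _ _ _ hP).
exact: (rep_ladm x (rep_mulF (rep_sRB eR hF) (rep_sRB eR hG)) hP).
Qed.

Lemma smash_rhs_pt U (P : seq (A * H) -> U) F G u v p q x :
  ladm P -> rep F u p -> rep G v q ->
  sw x (fun y z => RBrhs (fun l => P (sRB l)) (F y) (G z)) =
  sw x (fun y z => P [:: (rhs_act mulH invH mulA invA L Q Bp RX u v p q y,
                          mulH (Bp p) (Bp q) z)]).
Proof.
(* [RB_B_pt] turns the [H]-component into the image under [B] of the product found by representing
   the argument. *)
move=> hP hF hG; rewrite (RBrhs_mulF (ladm_sRB hP) x hF hG) RB_B_pt.
have hR := rep_sRB eR hF.
have h := rep_sRB eR (rep_mulF (rep_mulF (rep_mulF hF hR) hG) (rep_sS hR)).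
exact: (rep_ladm x h hP).
Qed.

End AtX.

(** * From points to elements by means of universal points *)

Local Notation condX X := (RB_cond (pconv (X := X) (mul_bmap H)) (pcompose (S_pt H))
  (pconv (mul_bmap A)) (pcompose (S_pt A)) (pconv la) (pconv ra) (pcompose B) (pcompose Rp)).
Local Notation cond1X X := (RB_cond1 (pcompose (X := X) (S_pt H))
  (pconv (mul_bmap A)) (pcompose (S_pt A)) (pconv la) (pconv ra) (pcompose B) (pcompose Rp)).
Local Notation cond2X X := (RB_cond2 (pconv (X := X) (mul_bmap H)) (pcompose (S_pt H))
  (pconv la) (pconv ra) (pcompose B) (pcompose Rp)).

Lemma prod_admZ U (f : AH -> U) c a h : adm f -> f (c *: a, h) = c *: f (a, h).
Proof. by case=> f1 _; rewrite (linZ c a (f1 h)). Qed.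

Lemma ladm_pureZ U (P : seq (A * H) -> U) c a h : ladm P ->
  P [:: (c *: a, h)] = c *: P [:: (a, h)].
Proof. by case=> h1 _; rewrite (prod_admZ c a h h1). Qed.

Definition ptA : pt AH A := liftl (co H) (pid A).
Definition ptH : pt AH H := liftr (co A) (pid H).

Lemma rep_pure : rep (fun s : AH => [:: s]) ptA ptH.
Proof.
move=> U f hf s; rewrite big_seq1; case: (hf) => f1 f2.
rewrite [f s](_ : _ = f (s.1, s.2)); last by case: s.
rewrite -[LHS](@sw_lr _ (co A) (co H) U (fun a h => f (a, h)) s) //.
apply: eq_sw => y z /=.
by rewrite (linZ _ _ (f2 _)) (linZ _ _ (f1 _)) !scalerA mulrC.
Qed.

(** [AH] times itself carries two independent generic tensors; this is the first one, and the counit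
    of the discarded factor is placed on the [A]-component. *)
Lemma rep_liftl : rep (fun z : prodC AH AH => [:: (ceps z.2 *: z.1.1, z.1.2)])
  (liftl AH ptA) (liftl AH ptH).
Proof.
move=> U f hf z; rewrite big_seq1 (prod_admZ _ _ _ hf); case: (hf) => f1 f2.
transitivity (ceps z.2 *: (\sum_(s <- [:: z.1]) f s)); first by rewrite big_seq1; case: z => -[].
rewrite (rep_pure hf) -(@sw_ll _ AH AH U (fun y w => f (ptA y, ptH w))).
apply: eq_sw => y w; rewrite -(linZ _ _ (f2 _)).
exact: (esym (linZ (ceps y.2) (ptA y.1) (f1 _))).
Qed.

Lemma rep_liftr : rep (fun z : prodC AH AH => [:: (ceps z.1 *: z.2.1, z.2.2)])
  (liftr AH ptA) (liftr AH ptH).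
Proof.
move=> U f hf z; rewrite big_seq1 (prod_admZ _ _ _ hf); case: (hf) => f1 f2.
transitivity (ceps z.1 *: (\sum_(s <- [:: z.2]) f s)); first by rewrite big_seq1; case: z => ? [].
rewrite (rep_pure hf) -(@sw_rr _ AH AH U (fun y w => f (ptA y, ptH w))).
apply: eq_sw => y w; rewrite -(linZ _ _ (f2 _)).
exact: (esym (linZ (ceps y.1) (ptA y.2) (f1 _))).
Qed.

Lemma ladm2_eq U (P Q : seq (A * H) -> seq (A * H) -> U) :
  (forall l', ladm (fun l => P l l')) -> (forall l, ladm (P l)) ->
  (forall l', ladm (fun l => Q l l')) -> (forall l, ladm (Q l)) ->
  (forall s t, P [:: s] [:: t] = Q [:: s] [:: t]) -> forall l l', P l l' = Q l l'.
Proof.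
move=> p1 p2 q1 q2 e l l'; case: (p1 l') => _ ->; case: (q1 l') => _ ->.
apply: eq_bigr => s _; case: (p2 [:: s]) => _ ->; case: (q2 [:: s]) => _ ->.
by apply: eq_bigr.
Qed.

Lemma ladm2_pure U (P : seq (A * H) -> seq (A * H) -> U) (z : prodC AH AH) :
  (forall l', ladm (fun l => P l l')) -> (forall l, ladm (P l)) ->
  sw z (fun y w => P [:: (ceps y.2 *: y.1.1, y.1.2)] [:: (ceps w.1 *: w.2.1, w.2.2)]) =
  P [:: z.1] [:: z.2].
Proof.
move=> p1 p2; rewrite -(@sw_lr _ AH AH U (fun s t => P [:: s] [:: t])).
- apply: eq_sw => -[[a h] t] [s [b g]] /=.
  by rewrite (ladm_pureZ _ _ _ (p1 _)) (ladm_pureZ _ _ _ (p2 _)).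
- by move=> t; case: (p1 [:: t]).
- by move=> s; case: (p2 [:: s]).
Qed.

Lemma smash_RB_points :
  (forall X, condX X) <->
  (forall U (P : seq (A * H) -> U), ladm P -> forall l l',
     P (smul (sRB l) (sRB l')) = RBrhs (fun l => P (sRB l)) l l').
Proof.
split=> [hc U P hP | hP X u v p q].
  have l1 l' : ladm (fun l => P (smul (sRB l) (sRB l'))).
    by apply: (@ladm_sRB _ (fun l => P (smul l (sRB l')))); exact: ladm_smull.
  have l2 l : ladm (fun l' => P (smul (sRB l) (sRB l'))).
    by apply: (@ladm_sRB _ (fun l' => P (smul (sRB l) l'))); exact: ladm_smulr.
  have r1 l' : ladm (fun l => RBrhs (fun l => P (sRB l)) l l').
    exact: (ladm_RBrhsl (ladm_sRB hP)).
  have r2 l : ladm (RBrhs (fun l => P (sRB l)) l) by exact: (ladm_RBrhsr (ladm_sRB hP)).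
  apply: ladm2_eq => // s t.
  (* Each side becomes a Sweedler sum over the two generic tensors, to which the hypothesis on
     points applies. *)
  rewrite -(@ladm2_pure _ (fun l l' => P (smul (sRB l) (sRB l'))) (s, t)) //.
  rewrite -(@ladm2_pure _ (RBrhs (fun l => P (sRB l))) (s, t)) //.
  by rewrite (smash_lhs_pt _ hP rep_liftl rep_liftr) (smash_rhs_pt _ hP rep_liftl rep_liftr) hc.
apply: pt_eq => x.
(* Applying the counit to the [H]-component recovers the point of [A] from the point of the smash
   product. *)
pose f (s : AH) : A := heps s.2 *: s.1.
have hf : adm f.
  split=> z; last exact: lin_hepsZ.
  exact: (@adm_scale _ (co A) A (heps (z : H)) _ (@id_adm _ A)).
have e (w : pt X A) (r : pt X H) : w x = sw x (fun y z => f (w y, r z)).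
  rewrite -[LHS](sw_counitr x (pt_adm w)); apply: eq_sw => y z.
  by rewrite /f /= pt_eps.
have hL := smash_lhs_pt x (ladm_sum hf) (rep_pair u p) (rep_pair v q).
have hR := smash_rhs_pt x (ladm_sum hf) (rep_pair u p) (rep_pair v q).
pose r := pconv (mul_bmap H) (pcompose B p) (pcompose B q).
rewrite (e (lhs_act _ _ _ _ _ _ _ _ _) r) (e (rhs_act _ _ _ _ _ _ _ _ _ _ _ _) r).
transitivity (sw x (fun y z => \sum_(s <- [:: (lhs_act (pconv (mul_bmap A)) (pconv la) (pconv ra)
  (pcompose B) (pcompose Rp) u v p q y, r z)]) f s)).
  by apply: eq_sw => y z; rewrite big_seq1.
rewrite -hL; transitivity (sw x (fun y z => \sum_(s <- [:: (rhs_act (pconv (mul_bmap H))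
  (pcompose (S_pt H)) (pconv (mul_bmap A)) (pcompose (S_pt A)) (pconv la) (pconv ra)
  (pcompose B) (pcompose Rp) u v p q y, r z)]) f s)); last first.
  by apply: eq_sw => y z; rewrite big_seq1.
by rewrite -hR; apply: eq_sw => y z; apply: (hP A (fun l => \sum_(s <- l) f s)); exact: ladm_sum.
Qed.

Lemma cond1_pointwise :
  (forall X, cond1X X) <->
  (forall a b h, Rp (cond1_arg a b h) = la (hS (B h)) (Rp a) * Rp b).
Proof.
have lR := lin_Rp; have lSA := @lin_S _ A; have lSH := @lin_S _ H; have lB := lin_B.
(* Substituting the three projections of the product of [A], [H] and [A] into a trilinear [F] gives
   back [F]. *)
have sub (F : A -> A -> H -> A) : (forall b h, lin (fun a => F a b h)) ->
    (forall a h, lin (fun b => F a b h)) -> (forall a b, lin (F a b)) ->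
    forall z : prodC AH (co A),
    sw z (fun y w => sw y (fun a h => F (liftl (co A) ptA a) (liftr AH (pid A) w)
      (liftl (co A) ptH h))) = F z.1.1 z.2 z.1.2.
  move=> f1 f2 f3 z.
  have h1 b : @adm k AH A (fun s => F s.1 b s.2) by split=> w; [exact: f1 | exact: f3].
  rewrite -(@sw_lr _ AH (co A) A (fun s b => F s.1 b s.2) z h1 (fun s => f2 _ _)).
  apply: eq_sw => y w; rewrite -(linZ _ _ (f2 _ _)).
  have h2 h : lin (fun a => F a (ceps w.1 *: w.2) h) by exact: f1.
  rewrite -(@sw_lr _ (co A) (co H) A (fun a h => F a (ceps w.1 *: w.2) h) y.1 h2 (f3^~ _)).
  rewrite -(@sw_ll _ AH (co A)); apply: eq_sw => a h /=.
  rewrite !(linZ _ _ (f1 _ _)) !(linZ _ _ (f3 _ _)) !scalerA; congr (_ *: _).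
  by rewrite -!mulrA; congr (_ * _); rewrite mulrCA.
split=> [hc a b h | hc X u v p]; last first.
  apply: pt_eq => x; rewrite cond1_pt cond1_rhs_pt.
  by apply: eq_sw => y z; apply: eq_sw => a h; rewrite hc.
have := congr1 (fun p : pt (prodC AH (co A)) A => p ((a, h), b))
  (hc _ (liftl (co A) ptA) (liftr AH (pid A)) (liftl (co A) ptH)).
rewrite cond1_pt cond1_rhs_pt.
rewrite (sub (fun a b h => Rp (cond1_arg a b h))); first last.
- by move=> {}a {}b; exact: (h_adm_lin (K := H) lR (cond1_linh a b)).
- by move=> {}a {}h; exact: (h_adm_lin (K := A) lR (cond1_linb a h)).
- by move=> {}b {}h; exact: (h_adm_lin (K := A) lR (cond1_lina b h)).
rewrite (sub (fun a b h => la (hS (B h)) (Rp a) * Rp b)) //.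
- move=> {}b {}h.
  exact: (h_adm_lin (K := A) (bilin_linl _ bA) (h_adm_lin (K := A) (bilin_linr _ bl) lR)).
- by move=> {}a {}h; exact: (h_adm_lin (K := A) (bilin_linr _ bA) lR).
- move=> {}a {}b; apply: (h_adm_lin (K := H) (bilin_linl _ bA)).
  exact: (h_adm_lin (K := H) (bilin_linl _ bl) (h_adm_lin (K := H) lSH lB)).
Qed.

Lemma cond2_pointwise :
  (forall X, cond2X X) <->
  (forall b h, Rp (cond2_arg b h) = ra (hS (B h)) (Rp b)).
Proof.
have lR := lin_Rp; have lSH := @lin_S _ H; have lB := lin_B.
split=> [hc b h | hc X v p]; last first.
  by apply: pt_eq => x; rewrite cond2_pt; apply: eq_sw => y z; rewrite hc.
(* The leaf for [H] comes first in [cond2_pt], so an exchange by cocommutativity of [AH] precedes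
   the evaluation at the projections. *)
have sub (F : A -> H -> A) : bilin F -> forall z : AH,
    sw z (fun y w => F (ptA w) (ptH y)) = F z.1 z.2.
  move=> hF z; rewrite -(@sw_lr _ (co A) (co H) A F z).
  - rewrite [RHS]sw_comm.
    + apply: eq_sw => y w /=.
      by rewrite (linZ _ _ (bilin_linl _ hF)) (linZ _ _ (bilin_linr _ hF)).
    + move=> y; split=> w /=; last exact: lin_hepsZ.
      by do 2!apply: (@adm_scale _ (co A) A); exact: (bilin_linl _ hF).
    + move=> y; split=> w /=; first by apply: (@adm_scale _ (co A) A); exact: lin_hepsZ.
      by do 2!apply: (@adm_scale _ (co H) A); exact: (bilin_linr _ hF).
  - by move=> v; exact: (bilin_linl _ hF).
  - by move=> v; exact: (bilin_linr _ hF).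
have := congr1 (fun p : pt AH A => p (b, h)) (hc _ ptA ptH).
rewrite cond2_pt (sub (fun b h => Rp (cond2_arg b h))); last first.
  apply: bilin_intro => r; first exact: (h_adm_lin (K := A) lR (cond2_linb r)).
  exact: (h_adm_lin (K := H) lR (cond2_linh r)).
move=> ->; apply: (sub (fun b h => ra (hS (B h)) (Rp b))).
apply: bilin_intro => r; first exact: (h_adm_lin (K := A) (bilin_linr _ br) lR).
exact: (h_adm_lin (K := H) (bilin_linl _ br) (h_adm_lin (K := H) lSH lB)).
Qed.

Theorem smash_RB_iff :
  (forall U (P : seq (A * H) -> U), ladm P -> forall l l',
     P (smul (sRB l) (sRB l')) = RBrhs (fun l => P (sRB l)) l l') <->
  (forall a b h, Rp (cond1_arg a b h) = la (hS (B h)) (Rp a) * Rp b) /\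
  (forall b h, Rp (cond2_arg b h) = ra (hS (B h)) (Rp b)).
Proof.
split=> [/smash_RB_points h | [/cond1_pointwise h1 /cond2_pointwise h2]].
  split; [apply/cond1_pointwise | apply/cond2_pointwise] => X;
    by case/(RB_cond_pt X): (h X).
by apply/smash_RB_points => X; apply/RB_cond_pt; split; [exact: h1 | exact: h2].
Qed.

(** The family of all pure tensors is represented by the universal points, hence so is its image
    under [Bbar], and [rep_cop] applies to that image. *)
Lemma sRB_cop l :
  sw_teq2 (X := SW) (scop (sRB l)) [seq (sRB p.1, sRB p.2) | p <- scop l].
Proof.
move=> U f hf; have [f1 f2] := sw_bilin_ladm hf.
rewrite big_map sum_scop (sum_scop (fun l l' => f (sRB l) (sRB l'))) sum_sRB_pure.
apply: eq_bigr => s _.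
have a1 t : @adm k AH U (fun s => f [:: s] [:: t]) by case: (f1 [:: t]).
have a2 t : @adm k AH U (fun s => f [:: t] [:: s]) by case: (f2 [:: t]).
rewrite (rep_cop (s : AH) (rep_sRB eR rep_pure) a1 a2); apply: eq_sw => y z.
case: (f1 (sRB [:: z])) => _ ->; apply: eq_bigr => r _.
by case: (f2 [:: r]) => _ ->.
Qed.

Lemma sRB_eps l :
  smash_eps (@heps _ A) (@heps _ H) (sRB l) = smash_eps (@heps _ A) (@heps _ H) l.
Proof.
rewrite /smash_eps (@sum_sRB_pure k^o (@ceps k AH)); apply: eq_bigr => s _.
rewrite (rep_sRB eR rep_pure (adm_ceps AH)) -[RHS](@sw_counitl _ AH k^o _ s (adm_ceps AH)).
apply: eq_bigr => -[y z] _.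
rewrite [ceps _]/(heps _ * heps _) !pt_eps.
by [].
Qed.

(** Once [R] is a coalgebra map, every clause of [is_RB] except the multiplicative identity holds
    for [Bbar]. *)
Lemma smash_is_RB :
  is_RB SW sRB <->
  (forall U (P : seq (A * H) -> U), ladm P -> forall l l',
     P (smul (sRB l) (sRB l')) = RBrhs (fun l => P (sRB l)) l l').
Proof.
split=> [[_ _ _ _ h] U P hP l l' | h].
  have /smash_eqvP e := h l l'; rewrite (e U P hP).
  exact: (RBrhsE _ _ (ladm_sRB hP)).
split; [exact: sRB_eqv | exact: sRB_lin | exact: sRB_cop | exact: sRB_eps |].
move=> l l'; apply/smash_eqvP => U P hP; rewrite [LHS]h //.
by symmetry; exact: (RBrhsE _ _ (ladm_sRB hP)).
Qed.

End PointConditions.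

End SmashProduct.

(** * Rota-Baxter operators *)

Section AlgebraRB.
Variables (k : fieldType) (K : chopf k).

Local Notation KW := (alg_swalg (@hcop _ K) (@heps _ K) (@hS _ K)).

Lemma sw_sum_alg (s : seq (sw_car KW)) : sw_sum (X := KW) s = \sum_(x <- s) (x : K).
Proof. by elim: s => [|x s IH]; rewrite ?big_nil // big_cons -IH. Qed.

Lemma is_RB_algP (f : K -> K) : is_RB KW f <->
  [/\ lin f,
      (forall (U : lmodType k) (g : K -> K -> U), bilin g -> forall x,
         sw (f x : co K) g = sw (x : co K) (fun y z => g (f y) (f z))),
      (forall x, heps (f x) = heps x) &
      (forall x y, f x * f y = f (sw (x : co K) (fun t c => sw (t : co K)
         (fun a b => a * f b * y * hS (f c)))))].
Proof.
have e x y : sw_sum (X := KW) [seq t.1.1 * f t.1.2 * y * hS (f t.2) | t <- cop2 (@hcop _ K) x] =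
    sw (x : co K) (fun t c => sw (t : co K) (fun a b => a * f b * y * hS (f c))).
  by rewrite sw_sum_alg big_map big_cop2.
split=> [[_ h1 h2 h3 h4] | [h1 h2 h3 h4]]; split=> //.
- move=> U g hg x; have hg' : sw_bilin (X := KW) g.
    by split=> [? ? ? -> | ? ? ? -> | |] //; [exact: hg.1 | exact: hg.2].
  by have := h2 x U g hg'; rewrite big_map.
- by move=> x y; rewrite -e; exact: h4.
- by move=> x x' /= ->.
- by move=> x U g [_ _ g1 g2]; rewrite big_map; apply: h2; split.
- by move=> x y; apply: (etrans (h4 x y)); rewrite -e.
Qed.

End AlgebraRB.

(** The group statement is used over the coalgebra [co K] and evaluated at [1], where the unit point
    takes the value [1]. *)
Lemma RB_1 (k : fieldType) (K : chopf k) (B : pt (co K) K) :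
  (forall x y : K, B x * B y = B (sw (x : co K) (fun t c => sw (t : co K)
     (fun a b => a * B b * y * hS (B c))))) -> B 1 = 1.
Proof.
move=> hB; have mul1 := @pmul_onel k (co K) K; have mulV := @pmulV k (co K) K.
have := B_1 (@pmulA k (co K) K) mul1 (@pmul_oner k (co K) K) mulV (@pmulVr k (co K) K)
  (fun p q => RB_B_pt hB p q).
by move/(congr1 (fun p : pt (co K) K => p 1)); rewrite /= heps1 scale1r.
Qed.

Theorem theorem2p2 (k : fieldType) (A H : algType k)
    (copA : A -> seq (A * A)) (epsA : A -> k) (SA : A -> A)
    (copH : H -> seq (H * H)) (epsH : H -> k) (SH : H -> H)
    (lact : H -> A -> A) (ract : A -> H -> A)
    (R : {linear A -> A}) (B : H -> H) :
  is_hopf copA epsA SA -> is_cocomm copA ->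
  is_hopf copH epsH SH -> is_cocomm copH ->
  is_bimod_hopf copA epsA SA copH epsH lact ract ->
  is_RB (alg_swalg copH epsH SH) B ->
  (is_RB (smash_swalg copA epsA SA copH epsH SH lact ract) (smash_RB copH lact ract R B)
   <->
   [/\ is_RB (alg_swalg copA epsA SA) R,
       (forall (a b : A) (h : H),
          R (\sum_(t <- cop2 copA a) \sum_(q <- copH h)
               ract (t.1.1 * R t.1.2) q.1 * b * lact q.2 (SA (R t.2)))
          = lact (SH (B h)) (R a) * R b) &
       (forall (b : A) (g : H),
          R (\sum_(t <- cop2 copH g) ract (lact (t.1.1 * B t.1.2) b) (SH (B t.2)))
          = ract (R b) (SH (B g)))]).
Proof.
move=> hopfA ccA hopfH ccH.
case=> [[bl br [la1 laM] [ra1 raM] la_ra] [laD _ raD _] [lcop rcop leps reps] _] hB.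
pose A' := CHopf hopfA ccA; pose H' := CHopf hopfH ccH.
have lcop' (U : lmodType k) (f : A' -> A' -> U) : bilin f -> forall (x : H') (y : A'),
    sw (lact x y : co A') f = sw (x : co H') (fun a b => sw (y : co A') (fun c d =>
      f (lact a c) (lact b d))).
  by move=> hf x y; have := lcop x y U f hf; rewrite big_allpairs_dep.
have rcop' (U : lmodType k) (f : A' -> A' -> U) : bilin f -> forall (x : H') (y : A'),
    sw (ract y x : co A') f = sw (x : co H') (fun a b => sw (y : co A') (fun c d =>
      f (ract c a) (ract d b))).
  move=> hf x y; have := rcop y x U f hf; rewrite big_allpairs_dep => e.
  by rewrite sw_exch.
have br' : bilin (fun (h : H') (a : A') => ract a h) by case: br => r1 r2; split=> *; rewrite (r1, r2).
pose la : bmap H' A' A' := @BMap k H' A' A' lact bl lcop' (fun h a => etrans (leps h a) (mulrC _ _)).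
(* The arguments of the right action are swapped so that both actions are pairings of [H] with [A]
   in this order. *)
pose ra : bmap H' A' A' := @BMap k H' A' A' (fun h a => ract a h) br' rcop' (fun h a => etrans (reps a h) (mulrC _ _)).
have [linB copB epsB RB_B] := proj1 (@is_RB_algP k H' B) hB.
pose Bp : pt (co H') H' := @Pt k (co H') H' B linB copB epsB.
have B1 : B 1 = 1 := @RB_1 k H' Bp RB_B.
have linR : lin R by move=> c x y; exact: linearP.
have cond1E (a b : A) h : \sum_(t <- cop2 copA a) \sum_(q <- copH h)
    ract (t.1.1 * R t.1.2) q.1 * b * lact q.2 (SA (R t.2)) =
    sw (a : co A') (fun t c => sw (t : co A') (fun a1 a2 => sw (h : co H') (fun h1 h2 =>
      ract (a1 * R a2) h1 * b * lact h2 (SA (R c))))).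
  by rewrite big_cop2.
have cond2E (b : A) g :
    \sum_(t <- cop2 copH g) ract (lact (t.1.1 * B t.1.2) b) (SH (B t.2)) =
    sw (g : co H') (fun t c => sw (t : co H') (fun h1 h2 =>
      ract (lact (h1 * B h2) b) (SH (B c)))).
  by rewrite big_cop2.
(* The equivalence is conditional on the coalgebra laws of [R]: one direction reads them off from
   its Rota-Baxter hypothesis, the other derives them from [Bbar] first. *)
have main (copR : forall (U : lmodType k) (g : A' -> A' -> U), bilin g -> forall x : A',
      sw (R x : co A') g = sw (x : co A') (fun y z => g (R y) (R z)))
    (epsR : forall x : A', epsA (R x) = epsA x) :=
  let Rp := @Pt k (co A') A' R linR copR epsR in
  iff_trans (@smash_is_RB k A' H' la ra R Bp linR Rp (fun _ => erefl))
    (@smash_RB_iff k A' H' la ra R Bp linR Rp (fun _ => erefl) RB_B la1 laM ra1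
       (fun h g a => raM a h g) (fun h g a => la_ra h a g) laD (fun h a b => raD a b h)).
split=> [hRB | [/(@is_RB_algP k A') [_ copR epsR _] h1 h2]]; last first.
  apply/(main copR epsR); split=> [a b h | b g].
    by have := h1 a b h; rewrite cond1E.
  by have := h2 b g; rewrite cond2E.
have [_ _ hcop heps _] := hRB.
have copR := @coalg_of_sRB k A' H' la ra R Bp linR B1 la1 ra1 hcop.
have epsR := @eps_of_sRB k A' H' la ra R Bp B1 la1 ra1 heps.
have [h1 h2] := proj1 (main copR epsR) hRB.
split=> [|a b h|b g]; [|by rewrite cond1E; exact: h1|by rewrite cond2E; exact: h2].
apply/(@is_RB_algP k A'); split=> // a b.
(* With this and [B 1 = 1], the first condition at [h = 1] is the Rota-Baxter identity of [R]. *)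
have S1 : SH 1 = 1.
  have e := @antipodel k H' 1; rewrite sw_1 in e; last first.
    by apply: bilin_intro => r; [exact: (h_adm_lin (K := H') (bilin_linl _ (bilin_mul H')) (@lin_S _ H')) | exact: (bilin_linr _ (bilin_mul H'))].
  by move: e; rewrite heps1 scale1r mulr1.
have := h1 a b 1; rewrite /= B1 S1 la1 => <-; congr (R _).
apply: eq_sw => t c; apply: eq_sw => a1 a2.
by rewrite (sw_1 (@cond1_bilin1 k A' H' la ra _ _ _)) /= la1 ra1.
Qed.
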